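(* Suppose $k^{pos}$ is a $C_0$-universal kernel on $\mathbb{R}^n$, $\gamma(1)>0$, and $\gamma(t)\neq\gamma(-t)$ for all $t\in[-1,1]\setminus\{0\}$. Let $(X,T(\cdot))$ and $(Y,S(\cdot))$ be two oriented $\mathcal{H}^d$-rectifiable sets in $\mathbb{R}^n$ with $\mathcal{H}^d(X),\mathcal{H}^d(Y)<\infty$. If $\|\mu_X-\mu_Y\|_{W^*}=0$, then $\mathcal{H}^d(X\bigtriangleup Y)=0$ and $T=S$ $\mathcal{H}^d$-a.e. (on $X\cap Y$).
   Context: Let $0\le d\le n$. $\widetilde{G}^n_d$ is the set of oriented $d$-dimensional linear subspaces of $\mathbb{R}^n$, identified with a subset of the unit sphere of $\Lambda^d(\mathbb{R}^n)$ by $T\mapsto \frac{u_1\wedge\cdots\wedge u_d}{|u_1\wedge\cdots\wedge u_d|}$ for any basis $(u_i)$ of $T$ consistent with its orientation, where $\Lambda^d(\mathbb{R}^n)$ carries the inner product $\langle \xi_1\wedge\cdots\wedge\xi_d,\eta_1\wedge\cdots\wedge\eta_d\rangle=\det(\xi_i\cdot\eta_j)_{i,j}$; $\langle S,T\rangle$ denotes this inner product restricted to $\widetilde{G}^n_d$, and $-T$ is $T$ with opposite orientation. An oriented $d$-varifold is a nonnegative finite Radon measure on $\mathbb{R}^n\times\widetilde{G}^n_d$; for a test function $\omega$, $(\mu|\omega)=\int\omega\,d\mu$. An oriented $\mathcal{H}^d$-rectifiable set is a pair $(X,T)$ where $X\subset\mathbb{R}^n$ is countably $\mathcal{H}^d$-rectifiable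 (i.e. $\mathcal{H}^d(X\setminus\bigcup_{j\ge1}F_j(\mathbb{R}^d))=0$ for some Lipschitz maps $F_j:\mathbb{R}^d\to\mathbb{R}^n$) and $T:X\to\widetilde{G}^n_d$ is $\mathcal{H}^d$-measurable with $T(x)$ equal, for $\mathcal{H}^d$-a.e. $x\in X$, to the approximate tangent space of $X$ at $x$ with a specified orientation. Its associated varifold $\mu_X$ is given by $(\mu_X|\omega)=\int_X\omega(x,T(x))\,d\mathcal{H}^d(x)$ (and similarly $\mu_Y$ from $(Y,S)$). Kernels: $k^{pos}(x,y)=\rho(|x-y|^2)$ and $k^G(S,T)=\gamma(\langle S,T\rangle)$ are continuous positive definite kernels on $\mathbb{R}^n$ and $\widetilde{G}^n_d$ respectively, with $\rho,\gamma$ continuous real functions, $\rho(0)>0$, and $k^{pos}(x,\cdot)\in C_0(\mathbb{R}^n)$ for every $x$. Here $C_0$ denotes continuous functions vanishing at infinity. $W$ is the reproducing kernel Hilbert space (RKHS) of the kernel $k((x,T),(x',T'))=k^{pos}(x,x')k^G(T,T')$ on $\mathbb{R}^n\times\widetilde{G}^n_d$; it is continuously embedded in $C_0(\mathbb{R}^n\times\widetilde{G}^n_d)$. For a finite signed Radon measure $\mu$, $\|\mu\|_{W^*}=\sup_{\omega\in W,\|\omega\|_W\le1}|(\mu|\omega)|$. A positive definite kernel on a metric space $\mathcal{M}$ is $C_0$-universal if its RKHS is dense in $C_0(\mathcal{M})$ for uniform convergence. *)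

(* Defs.v *)
From HB Require Import structures.
From mathcomp Require Import all_boot all_order all_algebra.
From mathcomp Require Import perm.
From mathcomp Require Import all_classical all_reals all_analysis.

Set Implicit Arguments.
Unset Strict Implicit.
Unset Printing Implicit Defensive.

Import Order.TTheory GRing.Theory Num.Theory.
Import numFieldNormedType.Exports.

Local Open Scope classical_set_scope.
Local Open Scope ring_scope.

(* The norm carried by ['rV[R]_n] in MathComp-Analysis is the sup norm; it
   induces the usual topology, but every metric notion below (kernels,
   diameters, Lipschitz maps) uses the Euclidean norm [enorm]. *)
Definition dotv (R : realType) (n : nat) (u v : 'rV[R]_n) : R :=
  \sum_(i < n) u 0 i * v 0 i.

Definition enorm (R : realType) (n : nat) (v : 'rV[R]_n) : R :=
  Num.sqrt (dotv v v).

(* Elements of the exterior power are written as alternating tensors, i.e. by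
   their coordinates on all maps f : {0..d-1} -> {0..n-1}; the coordinate of
   u_1 /\ ... /\ u_d at f is the minor det (u_i(f j))_(i,j).  Each basis
   d-vector e_I occurs once for each of the d! orderings of I, whence the
   factor 1/d! in [dotext]. *)
Notation extpow R n d := 'rV[R]_#|{ffun 'I_d -> 'I_n}|.

Definition wedgev (R : realType) (n d : nat) (u : 'I_d -> 'rV[R]_n) :
    extpow R n d :=
  \row_k \det (\matrix_(i < d, j < d) u i 0 ((enum_val k : {ffun 'I_d -> 'I_n}) j)).

Definition dotext (R : realType) (n d : nat) (xi eta : extpow R n d) : R :=
  (d`!)%:R^-1 * dotv xi eta.

Lemma dotext_wedge (R : realType) (n d : nat) (u v : 'I_d -> 'rV[R]_n) :
  dotext (wedgev u) (wedgev v) = \det (\matrix_(i < d, j < d) dotv (u i) (v j)).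
Proof.
have d0 : (d`!)%:R != 0 :> R by rewrite pnatr_eq0 -lt0n fact_gt0.
apply: (mulfI d0); rewrite mulVKf //.
pose a (f : {ffun 'I_d -> 'I_n}) (s : 'S_d) :=
  (-1) ^+ s * \prod_i u i 0 (f (s i)).
pose b (f : {ffun 'I_d -> 'I_n}) (s : 'S_d) :=
  (-1) ^+ s * \prod_i v i 0 (f (s i)).
transitivity (\sum_(f : {ffun 'I_d -> 'I_n}) (\sum_s a f s) * (\sum_t b f t)).
  rewrite /dotv (reindex (@enum_rank {ffun 'I_d -> 'I_n})) /=; last first.
    exact/onW_bij/enum_rank_bij.
  apply: eq_bigr => f _; rewrite !mxE enum_rankK.
  by congr (_ * _); apply: eq_bigr => s _; rewrite /a /b; congr (_ * _);
    apply: eq_bigr => i _; rewrite !mxE.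
have -> : \sum_(f : {ffun 'I_d -> 'I_n}) (\sum_s a f s) * (\sum_t b f t) =
    \sum_(s : 'S_d) \sum_(t : 'S_d)
      (-1) ^+ s * (-1) ^+ t * \prod_i dotv (u ((s^-1)%g i)) (v ((t^-1)%g i)).
  under eq_bigr do rewrite mulr_suml.
  rewrite exchange_big; apply: eq_bigr => s _ /=.
  under eq_bigr do rewrite mulr_sumr.
  rewrite exchange_big; apply: eq_bigr => t _ /=.
  rewrite /dotv bigA_distr_bigA /= mulr_sumr; apply: eq_bigr => f _.
  rewrite /a /b mulrACA; congr (_ * _); rewrite big_split /=; congr (_ * _).
    rewrite [RHS](reindex_inj (@perm_inj _ s)) /=.
    by apply: eq_bigr => i _; rewrite permK.
  rewrite [RHS](reindex_inj (@perm_inj _ t)) /=.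
  by apply: eq_bigr => i _; rewrite permK.
transitivity (\sum_(s : 'S_d) \det (\matrix_(i < d, j < d) dotv (u i) (v j))).
  apply: eq_bigr => s _.
  have hinj : injective (fun t : 'S_d => (s^-1 * t)^-1)%g.
    by move=> t1 t2 /invg_inj /mulgI.
  rewrite (reindex_inj hinj) /=.
  apply: eq_bigr => t _; rewrite odd_permV odd_permM odd_permV.
  rewrite signr_addb mulrA -signr_addb addbb mul1r; congr (_ * _).
  rewrite (reindex_inj (@perm_inj _ s)) /=; apply: eq_bigr => i _.
  by rewrite mxE invgK permK permM permK.
by rewrite sumr_const mulr_natl; congr (_ *+ _); rewrite card_Sn.
Qed.

(* The linear subspace P carries xi: xi is a multiple of the wedge product of
   a basis of P.  For a unit vector xi the sign of the multiple is the
   orientation; the multiple is needed when d = 0, where the empty basis gives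
   only one of the two orientations {1, -1} of the null space. *)
Definition orients (R : realType) (n d : nat) (xi : extpow R n d)
    (P : {vspace 'rV[R]_n}) : Prop :=
  exists2 u : d.-tuple 'rV[R]_n, basis_of P u &
    exists c : R, xi = c *: wedgev (tnth u).

Definition oriented_planes (R : realType) (n d : nat) : set (extpow R n d) :=
  [set xi | dotext xi xi = 1 /\ exists P, orients xi P].

(* The bound d <= n makes the type inhabited, as measurable spaces require. *)
Definition ograss (R : realType) (n d : nat) (hdn : (d <= n)%N) : Type :=
  set_type (@oriented_planes R n d).

HB.instance Definition _ (R : realType) (n d : nat) (hdn : (d <= n)%N) :=
  Uniform.copy (ograss R hdn) (set_type (@oriented_planes R n d)).
HB.instance Definition _ (R : realType) (n d : nat) (hdn : (d <= n)%N) :=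
  PseudoMetric.copy (ograss R hdn) (set_type (@oriented_planes R n d)).

Lemma oriented_planes_neq0 (R : realType) (n d : nat) (hdn : (d <= n)%N) :
  exists xi : ograss R hdn, True.
Proof.
pose u := [tuple delta_mx 0 (widen_ord hdn i) | i < d] : d.-tuple 'rV[R]_n.
have uE i j : tnth u i 0 (widen_ord hdn j) = (i == j)%:R.
  by rewrite tnth_mktuple mxE eqxx /= eq_sym -!val_eqE.
have ux : oriented_planes (wedgev (tnth u)).
  split.
    rewrite dotext_wedge -[RHS](det1 R d); congr (\det _).
    apply/matrixP => i j; rewrite !mxE /dotv (bigD1 (widen_ord hdn j)) //=.
    rewrite !uE eqxx mulr1 big1 ?addr0 // => k kj.
    by rewrite /u !tnth_mktuple !mxE (negbTE kj) andbF mulr0.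
  exists <<u>>%VS, u; last by exists 1; rewrite scale1r.
  rewrite /basis_of eqxx; apply/freeP => k k0 i.
  have := congr1 (fun M : 'rV[R]_n => M 0 (widen_ord hdn i)) k0.
  under eq_bigr => j _ do rewrite -tnth_nth.
  rewrite summxE mxE (bigD1 i) //= big1 => [|j ji].
    by rewrite mxE uE eqxx mulr1 addr0.
  by rewrite mxE uE (negbTE ji) mulr0.
by exists (SigSub (mem_set ux)).
Qed.

HB.instance Definition _ (R : realType) (n d : nat) (hdn : (d <= n)%N) :=
  isPointed.Build (ograss R hdn) (projT1 (cid (@oriented_planes_neq0 R n d hdn))).

(* Volume of the unit ball of R^d, from
   alpha_(d+2) = (2 pi / (d+2)) alpha_d. *)
Fixpoint ball_volume (R : realType) (d : nat) : R :=
  match d with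
  | 0%N => 1
  | 1%N => 2
  | d'.+2 => 2 * pi / d%:R * ball_volume R d'
  end.

Definition ediam (R : realType) (n : nat) (A : set 'rV[R]_n) : \bar R :=
  ereal_sup [set (enorm (p.1 - p.2))%:E | p in A `*` A].

(* With 0 ^ 0 = 1, so that the measure of dimension 0 counts points.  Only used
   on sets of finite diameter. *)
Definition ball_gauge (R : realType) (n d : nat) (A : set 'rV[R]_n) : \bar R :=
  if A == set0 then 0%E
  else (ball_volume R d * (fine (ediam A) / 2) ^+ d)%:E.

Definition hausdorff_pre (R : realType) (n d : nat) (delta : R)
    (A : set 'rV[R]_n) : \bar R :=
  ereal_inf [set (\sum_(k <oo) ball_gauge d (F k))%E
    | F in [set F : nat -> set 'rV[R]_n |
        (forall k, (ediam (F k) <= delta%:E)%E) /\ A `<=` \bigcup_k F k]].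

Definition hausdorff (R : realType) (n d : nat) (A : set 'rV[R]_n) : \bar R :=
  ereal_sup [set hausdorff_pre d delta A | delta in [set delta : R | 0 < delta]].

Section hausdorff_outer_measure.
Context (R : realType) (n d : nat).
Local Open Scope ereal_scope.

Let small_gauge (delta : R)
    (A : set (g_sigma_algebraType [set: set 'rV[R]_n])) : \bar R :=
  if ediam A <= delta%:E then ball_gauge d A else +oo.

Lemma ball_volume_ge0 (m : nat) : (0 <= ball_volume R m)%R.
Proof.
suff : (0 <= ball_volume R m)%R /\ (0 <= ball_volume R m.+1)%R by case.
elim: m => [|m [IH0 IH1]] //; split => //.
by rewrite /= mulr_ge0 // divr_ge0 // mulr_ge0 // pi_ge0.
Qed.

Lemma ediam_ge0 (A : set 'rV[R]_n) : A !=set0 -> 0 <= ediam A.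
Proof.
move=> [x Ax]; apply: ereal_sup_ubound; exists (x, x) => //=.
by rewrite subrr /enorm /dotv big1 ?sqrtr0 // => i _; rewrite mxE mul0r.
Qed.

Lemma ball_gauge_ge0 (A : set 'rV[R]_n) : 0 <= ball_gauge d A.
Proof.
rewrite /ball_gauge; case: ifPn => // /set0P A0.
rewrite lee_fin mulr_ge0 ?ball_volume_ge0 // exprn_ge0 // divr_ge0 //.
by rewrite fine_ge0 // ediam_ge0.
Qed.

Lemma small_gauge_ge0 delta A : 0 <= small_gauge delta A.
Proof. by rewrite /small_gauge; case: ifP => // _; exact: ball_gauge_ge0. Qed.

Lemma small_gauge0 delta : small_gauge delta set0 = 0.
Proof.
rewrite /small_gauge /ball_gauge eqxx /ediam set0X image_set0 ereal_sup0.
by rewrite leNye.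
Qed.

Lemma hausdorff_preE delta A :
  hausdorff_pre d delta A = mu_ext (small_gauge delta) A.
Proof.
apply/eqP; rewrite eq_le; apply/andP; split; last first.
  apply: le_ereal_inf_tmp => _ [F [Fd AF] <-]; apply: ereal_inf_lbound.
  exists F; first by split => // k; exact: sub_sigma_algebra.
  by apply: eq_eseriesr => k _; rewrite /small_gauge Fd.
apply: le_ereal_inf_tmp => _ [F [_ AF] <-].
have [Fd|] := pselect (forall k, ediam (F k) <= delta%:E).
  apply: ereal_inf_lbound; exists F => //.
  by apply: eq_eseriesr => k _; rewrite /small_gauge Fd.
move=> /existsNP[k /negP Fk].
rewrite (@eseries_pinfty _ _ _ k) ?leey //; last first.
  by rewrite /small_gauge (negbTE Fk).
by move=> i _; rewrite gt_eqF // (lt_le_trans _ (small_gauge_ge0 _ _)).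
Qed.

Lemma hausdorff0 : hausdorff d (set0 : set 'rV[R]_n) = 0.
Proof.
apply/eqP; rewrite eq_le; apply/andP; split.
  apply: ge_ereal_sup => _ [delta _ <-]; rewrite hausdorff_preE mu_ext0 //.
    exact: small_gauge0.
  exact: small_gauge_ge0.
apply: ereal_sup_ubound; exists 1%R; first exact: ltr01.
rewrite hausdorff_preE mu_ext0 //; [exact: small_gauge0|exact: small_gauge_ge0].
Qed.

Lemma hausdorff_ge0 (A : set 'rV[R]_n) : 0 <= hausdorff d A.
Proof.
apply: le_ereal_sup_tmp; exists (hausdorff_pre d 1 A).
  by exists 1%R => //; exact: ltr01.
by rewrite hausdorff_preE mu_ext_ge0 //; exact: small_gauge_ge0.
Qed.

Lemma le_hausdorff :
  {homo (@hausdorff R n d) : A B / A `<=` B >-> A <= B}.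
Proof.
move=> A B AB; apply: ge_ereal_sup => _ [delta delta0 <-].
apply: le_ereal_sup_tmp; exists (hausdorff_pre d delta B); first by exists delta.
by rewrite !hausdorff_preE; exact: le_mu_ext.
Qed.

Lemma hausdorff_sigma_subadditive : sigma_subadditive (@hausdorff R n d).
Proof.
move=> F; apply: ge_ereal_sup => _ [delta delta0 <-]; rewrite hausdorff_preE.
have := mu_ext_sigma_subadditive (@small_gauge_ge0 delta) F.
move=> /le_trans; apply.
apply: lee_nneseries => k _.
  by move=> _; apply: mu_ext_ge0; exact: small_gauge_ge0.
rewrite -hausdorff_preE; apply: le_ereal_sup_tmp.
by exists (hausdorff_pre d delta (F k)) => //; exists delta.
Qed.

HB.instance Definition _ := isOuterMeasure.Build R 'rV[R]_n (@hausdorff R n d)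
  hausdorff0 hausdorff_ge0 le_hausdorff hausdorff_sigma_subadditive.

End hausdorff_outer_measure.

(* R^n with the sigma-algebra of H^d-measurable (Caratheodory) sets. *)
Notation hausdorff_mspace R n d := (caratheodory_type (@hausdorff R n d)).

Definition hausdorff_measure (R : realType) (n d : nat) :
    set (hausdorff_mspace R n d) -> \bar R := @hausdorff R n d.

HB.instance Definition _ (R : realType) (n d : nat) :=
  isMeasure.Build _ _ _ (@hausdorff_measure R n d)
    (caratheodory_measure0 (@hausdorff R n d))
    (caratheodory_measure_ge0 (mu := @hausdorff R n d))
    (@caratheodory_measure_sigma_additive _ _ (@hausdorff R n d)).

Definition countably_rectifiable (R : realType) (n d : nat)
    (X : set 'rV[R]_n) : Prop :=
  exists2 F : nat -> 'rV[R]_d -> 'rV[R]_n,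
    (forall j, exists L : R, forall x y,
       enorm (F j x - F j y) <= L * enorm (x - y)) &
    hausdorff d (X `\` \bigcup_j range (F j)) = 0%E.

(* P is the approximate tangent space of X at x, by blow-up: the measures
   H^d restricted to (X - x) / r converge vaguely to H^d restricted to P as r
   decreases to 0. *)
Definition approx_tangent_space (R : realType) (n d : nat) (X : set 'rV[R]_n)
    (x : 'rV[R]_n) (P : {vspace 'rV[R]_n}) : Prop :=
  forall f : 'rV[R]_n -> R,
    continuous f -> compact (closure [set v | f v != 0]) ->
    (\int[@hausdorff_measure R n d]_(v in [set r^-1 *: (y - x) | y in X])
       (f v)%:E)%E @[r --> 0^'+] -->
    (\int[@hausdorff_measure R n d]_(v in [set v | v \in P]) (f v)%:E)%E.

Notation borel T := (g_sigma_algebraType (@open T)).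

(* T is a total function, of which only the values on X are used. *)
Definition oriented_rectifiable_set (R : realType) (n d : nat)
    (hdn : (d <= n)%N) (X : set 'rV[R]_n) (T : 'rV[R]_n -> ograss R hdn) :
    Prop :=
  [/\ countably_rectifiable d X,
      measurable (X : set (hausdorff_mspace R n d)),
      measurable_fun (X : set (hausdorff_mspace R n d))
        (T : hausdorff_mspace R n d -> borel (ograss R hdn)) &
      {ae @hausdorff_measure R n d, forall x, X x ->
        exists2 P, approx_tangent_space d X x P & orients (val (T x)) P}].

(* Finite Borel measures on this locally compact, second countable space are
   Radon measures. *)
Definition oriented_varifold (R : realType) (n d : nat) (hdn : (d <= n)%N) :
    Type :=
  {finite_measure set (borel ('rV[R]_n * ograss R hdn)%type) -> \bar R}.

Definition C0 (R : realType) (M : topologicalType) : set (M -> R) :=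
  [set f | continuous f /\
    forall e : R, 0 < e -> compact [set z | e <= `|f z|]].

Definition pairing (R : realType) (n d : nat) (hdn : (d <= n)%N)
    (mu : oriented_varifold R hdn) (w : 'rV[R]_n * ograss R hdn -> R) : R :=
  \int[mu]_z w z.

Definition associated_varifold (R : realType) (n d : nat) (hdn : (d <= n)%N)
    (X : set 'rV[R]_n) (T : 'rV[R]_n -> ograss R hdn)
    (mu : oriented_varifold R hdn) : Prop :=
  forall w, C0 w ->
    pairing mu w = \int[@hausdorff_measure R n d]_(x in X) w (x, T x).

Definition positive_definite_kernel (R : realType) (Z : Type)
    (k : Z -> Z -> R) : Prop :=
  (forall z z', k z z' = k z' z) /\
  forall (m : nat) (z : 'I_m -> Z) (c : 'I_m -> R),
    0 <= \sum_(i < m) \sum_(j < m) c i * c j * k (z i) (z j).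

Definition dot_norm (R : realType) (Z : Type)
    (dot : (Z -> R) -> (Z -> R) -> R) (f : Z -> R) : R :=
  Num.sqrt (dot f f).

(* The reproducing kernel Hilbert space of k: a real Hilbert space of functions
   on Z, with inner product [rkhs_dot], which contains the functions k z and in
   which they reproduce evaluation.  It is unique when it exists. *)
Record rkhs (R : realType) (Z : Type) (k : Z -> Z -> R) : Type := Rkhs {
  rkhs_set : set (Z -> R) ;
  rkhs_dot : (Z -> R) -> (Z -> R) -> R ;
  rkhs_zero : rkhs_set (fun=> 0) ;
  rkhs_lin : forall (c : R) f g, rkhs_set f -> rkhs_set g ->
    rkhs_set (fun z => c * f z + g z) ;
  rkhs_dotC : forall f g, rkhs_set f -> rkhs_set g ->
    rkhs_dot f g = rkhs_dot g f ;
  rkhs_dot_lin : forall (c : R) f g h,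
    rkhs_set f -> rkhs_set g -> rkhs_set h ->
    rkhs_dot (fun z => c * f z + g z) h = c * rkhs_dot f h + rkhs_dot g h ;
  rkhs_dot_ge0 : forall f, rkhs_set f -> 0 <= rkhs_dot f f ;
  rkhs_dot_eq0 : forall f, rkhs_set f -> rkhs_dot f f = 0 -> f = (fun=> 0) ;
  rkhs_complete : forall u : nat -> Z -> R, (forall i, rkhs_set (u i)) ->
    (forall e : R, 0 < e -> exists N, forall i j, (N <= i)%N -> (N <= j)%N ->
      dot_norm rkhs_dot (fun z => u i z - u j z) < e) ->
    exists2 f, rkhs_set f &
      dot_norm rkhs_dot (fun z => u i z - f z) @[i --> \oo] --> (0 : R) ;
  rkhs_kernel : forall z, rkhs_set (k z) ;
  rkhs_reproducing : forall f z, rkhs_set f -> rkhs_dot f (k z) = f z }.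

Definition C0_universal (R : realType) (M : topologicalType)
    (k : M -> M -> R) : Prop :=
  exists2 H : rkhs k, rkhs_set H `<=` @C0 R M &
    forall f, @C0 R M f -> forall e : R, 0 < e ->
      exists2 g, rkhs_set H g & forall z, `|f z - g z| <= e.

Definition dual_norm (R : realType) (Z : Type) (k : Z -> Z -> R) (W : rkhs k)
    (L : (Z -> R) -> R) : \bar R :=
  ereal_sup [set `|L w|%:E | w in 
    [set w | rkhs_set W w /\ dot_norm (rkhs_dot W) w <= 1]].

Definition kernel_pos (R : realType) (n : nat) (rho : R -> R)
    (x y : 'rV[R]_n) : R :=
  rho (enorm (x - y) ^+ 2).

Definition kernel_G (R : realType) (n d : nat) (hdn : (d <= n)%N)
    (gamma : R -> R) (S T : ograss R hdn) : R :=
  gamma (dotext (val S) (val T)).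

Definition kernel_prod (R : realType) (n d : nat) (hdn : (d <= n)%N)
    (rho gamma : R -> R) (z z' : 'rV[R]_n * ograss R hdn) : R :=
  kernel_pos rho z.1 z'.1 * kernel_G gamma z.2 z'.2.

(* Main.v *)
(* Testing with the kernel functions k((x, T0), .) shows that, for every
   oriented plane T0, the signed measure
   gamma<T0, T> H^d|X - gamma<T0, S> H^d|Y is annihilated by every kpos(x, .),
   hence vanishes by universality of kpos.  As H^d is Borel regular, its density
   gamma<T0, T> 1_X - gamma<T0, S> 1_Y is then zero almost everywhere, for a
   dense sequence of T0 and so, by continuity, for all T0 at once.  At almost
   every point of X \ Y this gives gamma(1) = 0 (take T0 = T), which is
   excluded.  At almost every point common to X and Y it gives
   gamma<T0, T> = gamma<T0, S> for all T0.  If S and T span different planes,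
   some T0 has <T0, T> = 0 and t = <T0, S> nonzero, and using T0 and - T0,
   gamma(t) = gamma(0) = gamma(- t), a contradiction; if S = - T, take T0 = T. *)
From HB Require Import structures.
Require Import Defs.
From mathcomp Require Import all_boot all_order all_algebra.
From mathcomp Require Import perm ring lra.
From mathcomp Require Import all_classical all_reals all_analysis.
From mathcomp Require Import measurable_realfun.

Set Implicit Arguments.
Unset Strict Implicit.
Unset Printing Implicit Defensive.

Import Order.TTheory GRing.Theory Num.Theory.
Import numFieldNormedType.Exports.

Local Open Scope classical_set_scope.
Local Open Scope ring_scope.

(** * Euclidean norm *)

(** The delicate point is the passage from integrals to densities. [H^d] is in general not
    sigma-finite, and T and S are only Caratheodory measurable, whereas test functions see Borel
    sets only. The difference of the two densities is therefore split into positive and negative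
    parts; the finite measures having these parts as densities agree on open sets, hence on Borel
    sets. The set where one part is positive lies in the union of X and Y, so it has finite mass and
    can be replaced by a Borel hull of the same mass. All this requires open sets to be Caratheodory
    measurable, that is, [H^d] to be a metric outer measure. Universality concerns the whole RKHS of
    kpos, while the functional is known to vanish only on the functions kpos(x, .). The gap closes
    because kpos is constant on the diagonal: approximation in the RKHS is then uniform, and the
    functional is bounded for the uniform norm. Compactness of the oriented Grassmannian serves
    twice: it makes k((x, T0), .) vanish at infinity, so that it may be tested against the
    varifolds, and it provides the dense sequence of planes. *)

Section euclidean.
Context (R : realType) (n : nat).
Implicit Types (u v w : 'rV[R]_n) (a : R).

Lemma dotv_mulmx u v : dotv u v = (u *m v^T) 0 0.
Proof. by rewrite mxE; apply: eq_bigr => i _; rewrite mxE. Qed.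

Lemma dotvC u v : dotv u v = dotv v u.
Proof. by apply: eq_bigr => i _; rewrite mulrC. Qed.

Lemma dotvDl u v w : dotv (u + v) w = dotv u w + dotv v w.
Proof. by rewrite !dotv_mulmx mulmxDl mxE. Qed.

Lemma dotvZl a u v : dotv (a *: u) v = a * dotv u v.
Proof. by rewrite !dotv_mulmx -scalemxAl mxE. Qed.

Lemma dotvDr u v w : dotv u (v + w) = dotv u v + dotv u w.
Proof. by rewrite dotvC dotvDl !(dotvC u). Qed.

Lemma dotvZr a u v : dotv u (a *: v) = a * dotv u v.
Proof. by rewrite dotvC dotvZl dotvC. Qed.

Lemma dotv_ge0 v : 0 <= dotv v v.
Proof. by apply: sumr_ge0 => i _; rewrite -expr2 sqr_ge0. Qed.

Lemma sqr_coord_le_dotv v i : v 0 i ^+ 2 <= dotv v v.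
Proof.
rewrite /dotv (bigD1 i) //= -expr2 lerDl.
by apply: sumr_ge0 => j _; rewrite -expr2 sqr_ge0.
Qed.

Lemma dotv_eq0 v : (dotv v v == 0) = (v == 0).
Proof.
apply/eqP/eqP => [v0|->]; last by rewrite /dotv big1 // => i _; rewrite mxE mul0r.
apply/rowP => i; rewrite mxE; apply/eqP; rewrite -sqrf_eq0.
by rewrite eq_le sqr_ge0 andbT -v0 sqr_coord_le_dotv.
Qed.

Lemma dotv_CauchySchwarz u v : dotv u v ^+ 2 <= dotv u u * dotv v v.
Proof.
have [->|v0] := eqVneq v 0.
  by rewrite -[in leLHS](scale0r u) dotvZr mul0r expr0n mulr_ge0 // dotv_ge0.
have vv : 0 < dotv v v by rewrite lt_neqAle eq_sym dotv_eq0 v0 dotv_ge0.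
(* The squared norm of this vector is [dotv v v] times the defect in the inequality. *)
have := dotv_ge0 (dotv v v *: u + (- dotv u v) *: v).
rewrite !(dotvDl, dotvDr, dotvZl, dotvZr) (dotvC v u) => h.
have : 0 <= dotv v v * (dotv u u * dotv v v - dotv u v ^+ 2) by nra.
by rewrite pmulr_rge0 // subr_ge0.
Qed.

Lemma enorm_ge0 v : 0 <= enorm v.
Proof. exact: sqrtr_ge0. Qed.

Lemma enorm0 : enorm (0 : 'rV[R]_n) = 0.
Proof. by rewrite /enorm (_ : dotv _ _ = 0) ?sqrtr0 //; apply/eqP; rewrite dotv_eq0. Qed.

Lemma sqr_enorm v : enorm v ^+ 2 = dotv v v.
Proof. by rewrite sqr_sqrtr // dotv_ge0. Qed.

Lemma enormN v : enorm (- v) = enorm v.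
Proof. by rewrite /enorm -scaleN1r dotvZl dotvZr mulrA mulrNN !mul1r. Qed.

Lemma enormC u v : enorm (u - v) = enorm (v - u).
Proof. by rewrite -opprB enormN. Qed.

Lemma dotv_le_enorm u v : dotv u v <= enorm u * enorm v.
Proof.
apply: le_trans (ler_norm _) _.
rewrite -(@ler_pXn2r _ 2) // ?nnegrE ?mulr_ge0 ?enorm_ge0 //.
by rewrite real_normK ?num_real // exprMn !sqr_enorm dotv_CauchySchwarz.
Qed.

Lemma enormD u v : enorm (u + v) <= enorm u + enorm v.
Proof.
rewrite -(@ler_pXn2r _ 2) // ?nnegrE ?addr_ge0 ?enorm_ge0 //.
rewrite sqrrD !sqr_enorm dotvDl !dotvDr (dotvC v u).
by have := dotv_le_enorm u v; lra.
Qed.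

Lemma enorm_triangle w u v : enorm (u - v) <= enorm (u - w) + enorm (w - v).
Proof. by apply: le_trans (enormD _ _); rewrite addrA subrK. Qed.

Lemma coord_le_norm v i : `|v 0 i| <= `|v|.
Proof.
rewrite [leRHS]/Num.norm /= mx_normrE.
by apply: (le_bigmax _ (fun j : 'I_1 * 'I_n => `|v j.1 j.2|) (0, i)).
Qed.

Lemma norm_le_enorm v : `|v| <= enorm v.
Proof.
rewrite [leLHS]/Num.norm /= mx_normrE; apply/bigmax_leP; split=> [|[i j] _] /=.
  exact: enorm_ge0.
by rewrite ord1 -sqrtr_sqr ler_sqrt ?dotv_ge0 // sqr_coord_le_dotv.
Qed.

(** The sharp constant is the square root of n; [n] does as well since n <= n^2, and only the
    topology is at stake. *)
Lemma enorm_le_norm v : enorm v <= n%:R * `|v|.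
Proof.
rewrite -(@ler_pXn2r _ 2) // ?nnegrE ?mulr_ge0 ?enorm_ge0 //.
rewrite sqr_enorm exprMn.
apply: (@le_trans _ _ (\sum_(i < n) `|v| ^+ 2)).
  apply: ler_sum => i _; rewrite -expr2 -[leLHS]real_normK ?num_real //.
  by rewrite lerXn2r ?nnegrE // coord_le_norm.
rewrite sumr_const card_ord -[leLHS]mulr_natl ler_wpM2r ?sqr_ge0 // -natrX ler_nat.
by rewrite -mulnn; case: (n) => // m; rewrite leq_pmulr.
Qed.

Lemma near_enorm v (e : R) : 0 < e -> \forall w \near v, enorm (v - w) < e.
Proof.
move=> e0; near=> w; apply: le_lt_trans (enorm_le_norm _) _.
(* [n.+1] replaces [n], which may be 0, so that it can be divided by. *)
have n0 : 0 < n.+1%:R :> R by [].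
apply: (@le_lt_trans _ _ (n.+1%:R * `|v - w|)).
  by rewrite ler_wpM2r // ler_nat.
rewrite mulrC -ltr_pdivlMr //.
near: w; apply: cvgr_dist_lt; rewrite ?divr_gt0 //; exact: cvg_id.
Unshelve. all: by end_near. Qed.

Lemma enorm_lipschitz_continuous (phi : 'rV[R]_n -> R) :
  (forall x y, `|phi x - phi y| <= enorm (x - y)) -> continuous phi.
Proof.
move=> phiL x; apply/(@cvgrPdist_lt _ _ _ (nbhs x)) => e e0.
by apply: filterS (near_enorm x e0) => y; apply: le_lt_trans (phiL x y).
Qed.

(** [phi] is the Euclidean distance to the complement of U. It turns every open set into a
    superlevel set of a 1-Lipschitz function. *)
Lemma open_enorm_distance (U : set 'rV[R]_n) : open U ->
  exists phi : 'rV[R]_n -> R,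
    [/\ forall x y, `|phi x - phi y| <= enorm (x - y), forall x, 0 <= phi x
      & forall x, U x <-> 0 < phi x].
Proof.
move=> oU; have [UT|/set0P[z0 Uz0]] := eqVneq (~` U) set0.
  (* With an empty complement there is no distance to take; a positive constant serves. *)
  exists (fun=> 1); split => [x y|x|x]; rewrite ?subrr ?normr0 ?enorm_ge0 //.
  by split=> // _; rewrite -[U]setCK UT setC0.
pose E x := [set enorm (x - z) | z in ~` U].
have hE x : has_inf (E x).
  by split; [exists (enorm (x - z0)), z0|exists 0 => _ [z _ <-]; exact: enorm_ge0].
have phi0 x : 0 <= inf (E x).
  by apply: lb_le_inf; [case: (hE x)|move=> _ [z _ <-]; exact: enorm_ge0].
have half x y : inf (E x) <= enorm (x - y) + inf (E y).
  rewrite -lerBlDl; apply: lb_le_inf; first by case: (hE y).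
  move=> _ [z Uz <-]; rewrite lerBlDl.
  apply: le_trans (enorm_triangle y _ _).
  by apply: ge_inf; [case: (hE x)|exists z].
exists (fun x => inf (E x)); split => // [x y|x].
  by have := half x y; have := half y x; rewrite enormC ler_norml; lra.
split=> [Ux|]; last first.
  apply: contraPP => Ux; apply/negP; rewrite -leNgt -(enorm0) -(subrr x).
  by apply: ge_inf; [case: (hE x)|exists x].
have := oU; rewrite openE => /(_ _ Ux) /nbhs_ballP[e /= e0 eU].
apply: lt_le_trans e0 _; apply: lb_le_inf; first by case: (hE x).
move=> _ [z Uz <-]; rewrite leNgt; apply/negP => xz; apply: Uz; apply: eU.
by rewrite -ball_normE /ball_ /=; apply: le_lt_trans (norm_le_enorm _) xz.
Qed.

End euclidean.

(** * Hausdorff measure: Borel sets and Borel regularity *)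

Section hausdorff_metric_outer.
Context (R : realType) (n d : nat).
Implicit Types (A B Z U : set 'rV[R]_n) (phi : 'rV[R]_n -> R).
Local Notation H := (@hausdorff R n d).
Local Open Scope ereal_scope.

Lemma ball_gauge0 : ball_gauge d (set0 : set 'rV[R]_n) = 0.
Proof. by rewrite /ball_gauge eqxx. Qed.

Lemma ediam_set0 : ediam (set0 : set 'rV[R]_n) = -oo.
Proof. by rewrite /ediam set0X image_set0 ereal_sup0. Qed.

Lemma le_hausdorff_pre (delta delta' : R) A : (delta <= delta')%R ->
  hausdorff_pre d delta' A <= hausdorff_pre d delta A.
Proof.
move=> dd; apply: le_ereal_inf => _ [F [Fd AF] <-]; exists F => //; split => // k.
by apply: le_trans (Fd k) _; rewrite lee_fin.
Qed.

Lemma hausdorff_pre_le (delta : R) A : (0 < delta)%R -> hausdorff_pre d delta A <= H A.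
Proof. by move=> d0; apply: ereal_sup_ubound; exists delta. Qed.

(** A set of diameter at most [delta] cannot meet both A and B, so a cover of the union splits into
    a cover of A and a cover of B that share no nonempty set. [G C] keeps the members meeting C and
    empties the others. *)
Lemma hausdorff_pre_separated (delta eta : R) A B : (delta < eta)%R ->
  (forall x y, A x -> B y -> eta <= enorm (x - y))%R ->
  hausdorff_pre d delta A + hausdorff_pre d delta B <= hausdorff_pre d delta (A `|` B).
Proof.
move=> de AB; apply: le_ereal_inf_tmp => _ [F [Fd ABF] <-].
pose G C k := if F k `&` C == set0 then set0 else F k.
have preG C : C `<=` A `|` B ->
    hausdorff_pre d delta C <= \sum_(k <oo) ball_gauge d (G C k).
  move=> CAB; apply: ereal_inf_lbound; exists (G C) => //; split => [k|x Cx].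
    by rewrite /G; case: ifP => // _; rewrite ediam_set0 leNye.
  have [k _ Fkx] := ABF _ (CAB _ Cx); exists k => //; rewrite /G.
  by case: ifPn => // /eqP; rewrite -subset0 => /(_ x); apply.
apply: le_trans (leeD (preG A _) (preG B _)) _; [by left|by right|].
rewrite -nneseriesD; [|by move=> *; exact: ball_gauge_ge0..].
apply: lee_nneseries => k _.
  by move=> _; rewrite adde_ge0 // ball_gauge_ge0.
rewrite /G; case: ifPn => [_|/set0P[x [Fx Ax]]]; case: ifPn => [_|/set0P[y [Fy By]]];
  rewrite ?ball_gauge0 ?adde0 ?add0e //; first exact: ball_gauge_ge0.
exfalso; have : (enorm (x - y))%:E <= delta%:E.
  by apply: le_trans (Fd k); apply: ereal_sup_ubound; exists (x, y).
by rewrite lee_fin leNgt (lt_le_trans de) // AB.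
Qed.

Lemma hausdorff_separated (eta : R) A B : (0 < eta)%R ->
  (forall x y, A x -> B y -> eta <= enorm (x - y))%R ->
  H A + H B <= H (A `|` B).
Proof.
move=> eta0 AB; have [->|Hoo] := eqVneq (H (A `|` B)) +oo; first exact: leey.
have finH C : C `<=` A `|` B -> H C \is a fin_num.
  move=> CAB; rewrite ge0_fin_numE ?hausdorff_ge0 //.
  by apply: le_lt_trans (le_hausdorff d CAB) _; rewrite ltey.
apply/lee_addgt0Pr => e e0; have e20 : (0 < e / 2)%R by rewrite divr_gt0.
have [_ [da da0 <-] hA] := @ub_ereal_sup_adherent _ _ _ e20
  (finH A (fun x Ax => or_introl Ax)).
have [_ [db db0 <-] hB] := @ub_ereal_sup_adherent _ _ _ e20
  (finH B (fun x Bx => or_intror Bx)).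
(* Below [eta], so that premeasures add, and below both near-optimal scales, since the premeasure
   grows as the scale shrinks. *)
pose delta := Num.min (eta / 2)%R (Num.min da db).
have delta0 : (0 < delta)%R by rewrite !lt_min da0 db0 divr_gt0.
have deltaeta : (delta < eta)%R.
  by apply: (@le_lt_trans _ _ (eta / 2)%R); rewrite ?ge_min ?lexx // ltr_pdivrMr //; lra.
have := hausdorff_pre_separated deltaeta AB.
have := hausdorff_pre_le (A `|` B) delta0.
have pa : hausdorff_pre d da A <= hausdorff_pre d delta A.
  by apply: le_hausdorff_pre; rewrite !ge_min lexx orbT.
have pb : hausdorff_pre d db B <= hausdorff_pre d delta B.
  by apply: le_hausdorff_pre; rewrite !ge_min lexx !orbT.
move=> h1 /le_trans /(_ h1) h2.
have h3 : H A - (e / 2)%:E + (H B - (e / 2)%:E) <= H (A `|` B).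
  by apply: le_trans h2; apply: leeD; apply: ltW;
    [apply: lt_le_trans hA pa|apply: lt_le_trans hB pb].
move: h3 (finH A (fun x Ax => or_introl Ax)) (finH B (fun x Bx => or_intror Bx)).
case: (H (A `|` B)) Hoo => [r| |] // _; case: (H A) => // a; case: (H B) => // b.
by rewrite -!EFinN -!EFinD !lee_fin => h _ _; lra.
Qed.

Lemma hausdorff_lipschitz_separated phi (s t : R) A B :
  (forall x y, `|phi x - phi y| <= enorm (x - y))%R -> (s < t)%R ->
  (forall x, A x -> phi x <= s)%R -> (forall x, B x -> t <= phi x)%R ->
  H A + H B <= H (A `|` B).
Proof.
move=> phiL st As Bt; apply: (@hausdorff_separated (t - s)).
  by rewrite subr_gt0.
move=> x y /As xs /Bt ty; apply: le_trans (phiL x y).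
by rewrite ler_normr; apply/orP; right; lra.
Qed.

Lemma invS_lt (k : nat) : (k.+2%:R^-1 < k.+1%:R^-1 :> R)%R.
Proof. by rewrite ltf_pV2 ?posrE // ltr_nat. Qed.

(* The layers [ring k] that are two apart are at positive distance, so their
   masses telescope and the sum of all of them is at most [2 * H Z]. *)
Lemma hausdorff_caratheodory_gt0 phi :
  (forall x y, `|phi x - phi y| <= enorm (x - y))%R ->
  H.-caratheodory [set x | 0 < phi x]%R.
Proof.
move=> phiL; apply: le_caratheodory_measurable => Z.
change (H (Z `&` [set x | 0 < phi x]%R) + H (Z `&` ~` [set x | 0 < phi x]%R) <= H Z).
have [->|Zoo] := eqVneq (H Z) +oo; first exact: leey.
pose far k := Z `&` [set x | k.+1%:R^-1 < phi x]%R.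
pose ring k := Z `&` [set x | k.+2%:R^-1 < phi x <= k.+1%:R^-1]%R.
have farZ k : H (far k) <= H Z by apply: le_hausdorff => x [].
(* On [ring k.+1], [phi] is at most 1/(k+2); on [far k] it exceeds 1/(k+1). *)
have step k : H (ring k.+1) + H (far k) <= H (far k.+2).
  apply: (le_trans (hausdorff_lipschitz_separated phiL (invS_lt k) _ _)).
  - by move=> x [_ /andP[]].
  - by move=> x [_ /ltW].
  - apply: le_hausdorff => x [[Zx /andP[xk _]]|[Zx xk]]; split => //=.
    by apply: lt_trans xk; apply: lt_trans (invS_lt _) (invS_lt _).
(* Even and odd layers telescope together, hence two boundary terms on each side. *)
have tele K : \sum_(0 <= k < K) H (ring k.+1) + (H (far 0%N) + H (far 1%N)) <=
    H (far K) + H (far K.+1).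
  elim: K => [|K IH]; first by rewrite big_nil add0e.
  rewrite big_nat_recr //= addeAC [leRHS]addeC.
  apply: le_trans (leeD (step K) (lexx _)).
  by rewrite addeC -addeA; apply: leeD => //; rewrite addeC.
have sumoo : \sum_(k <oo) H (ring k.+1) < +oo.
  apply: (@le_lt_trans _ _ (H Z + H Z)); last by rewrite lte_add_pinfty // ltey.
  apply: lime_le; first by apply: is_cvg_nneseries => *; exact: hausdorff_ge0.
  apply: nearW => K; apply: le_trans (leeD (farZ K) (farZ K.+1)).
  by apply: le_trans (tele K); rewrite leeDl // adde_ge0 // hausdorff_ge0.
have tail0 := nneseries_tail_cvg sumoo (fun k _ => hausdorff_ge0 d (ring k.+1)).
apply/lee_addgt0Pr => e e0.
have [N Ntail] : exists N, \sum_(N <= k <oo) H (ring k.+1) <= e%:E.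
  move/fine_cvgP : tail0 => [finT /cvgrPdist_lt /(_ _ e0) cT].
  have [N _ /(_ N (leqnn N))[fN]] := filterI finT cT.
  rewrite sub0r normrN => /ltW h; exists N; rewrite -(fineK fN) lee_fin.
  by apply: le_trans h; exact: ler_norm.
have cover : Z `&` [set x | 0 < phi x]%R `<=`
    far N.+1 `|` \bigcup_(k in ~` `I_N) ring k.+1.
  move=> x [Zx /= px]; have [xN|xN] := ltP (N.+2%:R^-1)%R (phi x); first by left.
  have [k0 hk0] : exists k : nat, (k.+1%:R^-1 < phi x)%R.
    have [k hk] := ltr_add_invr px; exists k; by rewrite add0r in hk.
  (* The least [m] with 1/(m+1) < phi x places x in [ring m.-1], which has index [m.-2] in the
     tail. *)
  have [m hm mmin] := ex_minnP (ex_intro (fun k : nat => (k.+1%:R^-1 < phi x)%R) k0 hk0).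
  have mN : (N.+2 <= m)%N.
    rewrite ltnNge; apply/negP => mN; move: hm; rewrite ltNge (le_trans xN) //.
    by rewrite lef_pV2 ?posrE // ler_nat ltnS.
  right; exists m.-2 => /=; first by apply/negP; rewrite -leqNgt; case: m mN {hm mmin} => [|[]].
  case: m mN hm mmin => [|[|m]] // _ hm mmin; split => //=; rewrite hm /= leNgt.
  by apply/negP => /mmin; rewrite ltnn.
have -> : Z `&` ~` [set x | 0 < phi x]%R = Z `&` [set x | phi x <= 0]%R.
  by congr (_ `&` _); apply/seteqP; split => x /=; rewrite leNgt => /negP.
have : H (Z `&` [set x | phi x <= 0]%R) + H (far N.+1) <= H Z.
  apply: (@le_trans _ _ (H (Z `&` [set x | phi x <= 0]%R `|` far N.+1))).
    apply: (hausdorff_lipschitz_separated phiL (_ : 0 < N.+2%:R^-1)%R) => //.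
    - by move=> x [].
    - by move=> x [_ /ltW].
  by apply: le_hausdorff => x [[]|[]].
have : H (Z `&` [set x | 0 < phi x]%R) <= H (far N.+1) + e%:E.
  apply: le_trans (le_hausdorff d cover) _.
  apply: le_trans (outer_measureU2 H _ _) _; apply: leeD => //.
  by apply: le_trans (outer_measure_sigma_subadditive_tail H N (fun k => ring k.+1)) _.
move=> h1 h2; apply: le_trans (leeD h1 (lexx _)) _.
by rewrite addeAC addeC (addeC (H (far _))) addeC; apply: leeD.
Qed.

Lemma open_hausdorff_measurable U : open U ->
  measurable (U : set (hausdorff_mspace R n d)).
Proof.
move=> /open_enorm_distance[phi [phiL _ phiU]].
rewrite (_ : U = [set x | 0 < phi x]%R); first exact: hausdorff_caratheodory_gt0.
by apply/seteqP; split => x /phiU.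
Qed.

Lemma borel_hausdorff_measurable (B : set (borel 'rV[R]_n)) : measurable B ->
  measurable (B : set (hausdorff_mspace R n d)).
Proof.
apply: smallest_sub; first exact: sigma_algebra_measurable.
by move=> U; exact: open_hausdorff_measurable.
Qed.

Lemma hausdorff_null_measurable (A : set (hausdorff_mspace R n d)) :
  H A = 0 -> measurable A.
Proof.
move=> A0; apply: le_caratheodory_measurable => Z.
change (H (Z `&` A) + H (Z `&` ~` A) <= H Z).
rewrite (_ : H (Z `&` A) = 0) ?add0e; first exact: le_hausdorff (@subIsetl _ _ _).
by apply/eqP; rewrite eq_le hausdorff_ge0 andbT -A0; exact: le_hausdorff (@subIsetr _ _ _).
Qed.

Lemma le_ediam A B : A `<=` B -> ediam A <= ediam B.
Proof.
move=> AB; apply: le_ereal_sup => _ [[x y] [/= Ax Ay] <-]; exists (x, y) => //.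
by split; exact: AB.
Qed.

Lemma ediam_closure A : ediam (closure A) = ediam A.
Proof.
apply/eqP; rewrite eq_le; apply/andP; split; last exact/le_ediam/subset_closure.
apply: ge_ereal_sup => _ [[x y] [/= Ax Ay] <-].
apply/lee_addgt0Pr => e e0; have e20 : (0 < e / 2)%R by rewrite divr_gt0.
have [x' [Ax' xx']] := Ax _ (near_enorm x e20).
have [y' [Ay' yy']] := Ay _ (near_enorm y e20).
apply: (@le_trans _ _ ((enorm (x' - y'))%:E + e%:E)); last first.
  by apply: leeD => //; apply: ereal_sup_ubound; exists (x', y').
rewrite -EFinD lee_fin; have := enorm_triangle x' x y; have := enorm_triangle y' x' y.
by move: yy'; rewrite (enormC y) /= => ? ? ?; have := xx'; rewrite /=; lra.
Qed.

Lemma ball_gauge_closure A : ball_gauge d (closure A) = ball_gauge d A.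
Proof.
rewrite /ball_gauge ediam_closure; congr (if _ then _ else _).
by apply/eqP/eqP => [A0|->]; [rewrite -subset0 -A0; exact: subset_closure|rewrite closure0].
Qed.

(** Closing the members of a cover changes neither their diameters nor their gauges. B is the
    intersection, over the scales 1/(m+1), of the unions of closed covers that are optimal up to
    1/(m+1); they exist because [H A] is finite. *)
Lemma hausdorff_borel_regular A : H A < +oo ->
  exists B : set 'rV[R]_n,
    [/\ measurable (B : set (borel 'rV[R]_n)), A `<=` B & H B = H A].
Proof.
move=> Aoo; pose dl (m : nat) : R := m.+1%:R^-1%R.
have dl0 m : (0 < dl m)%R by rewrite invr_gt0.
have /choice[F FP] m : exists F : nat -> set 'rV[R]_n,
    [/\ forall k, ediam (F k) <= (dl m)%:E, A `<=` \bigcup_k F k &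
        \sum_(k <oo) ball_gauge d (F k) <= H A + (dl m)%:E].
  have pfin : hausdorff_pre d (dl m) A \is a fin_num.
    rewrite ge0_fin_numE; first exact: le_lt_trans (hausdorff_pre_le _ (dl0 m)) Aoo.
    apply: le_ereal_inf_tmp => _ [F _ <-]; apply: nneseries_ge0 => k _ _.
    exact: ball_gauge_ge0.
  have [_ [F [Fd AF] <-] /ltW hF] := lb_ereal_inf_adherent (dl0 m) pfin.
  exists F; split => //; apply: le_trans hF _; apply: leeD => //.
  exact: hausdorff_pre_le.
pose B := \bigcap_m \bigcup_k closure (F m k).
have AB : A `<=` B.
  move=> x Ax m _; have [_ /(_ _ Ax)[k _ Fx] _] := FP m; exists k => //.
  exact: subset_closure.
exists B; split => //.
  apply: bigcap_measurable => // m _; apply: bigcup_measurable => k _.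
  rewrite -[X in measurable X]setCK; apply: measurableC; apply: sub_sigma_algebra.
  exact/closed_openC/closed_closure.
apply/eqP; rewrite eq_le (le_hausdorff d AB) andbT.
apply: ge_ereal_sup => _ [delta /= delta0 <-].
apply/lee_addgt0Pr => e e0.
have [m hm] : exists m, (dl m < Num.min delta e)%R.
  have [m hm] := @ltr_add_invr R 0%R (Num.min delta e) ltac:(by rewrite lt_min delta0).
  by exists m; rewrite add0r in hm.
move: hm; rewrite lt_min => /andP[/ltW md /ltW me].
apply: le_trans (le_hausdorff_pre _ md) _.
have [Fd _ Fs] := FP m.
apply: le_trans (_ : _ <= H A + (dl m)%:E) _; last by apply: leeD => //; rewrite lee_fin.
apply: le_trans Fs; apply: ereal_inf_lbound; exists (closure \o F m).
  by split => [k|x /(_ m I)//]; rewrite ediam_closure.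
by apply: eq_eseriesr => k _; rewrite ball_gauge_closure.
Qed.

End hausdorff_metric_outer.

(** * Oriented planes *)

Section wedge.
Context (R : realType) (n d : nat).
Implicit Types (U V : 'M[R]_(d, n)) (xi eta : extpow R n d).

(** Frames are packed as matrices so that a change of basis is a left multiplication and the Gram
    matrix is [U *m V^T]. *)
Definition wedge_rows U : extpow R n d := wedgev (fun i => row i U).

Lemma wedge_rows_mulmx (A : 'M[R]_d) U : wedge_rows (A *m U) = \det A *: wedge_rows U.
Proof.
apply/rowP => k; rewrite !mxE -det_mulmx; congr (\det _).
apply/matrixP => i j; rewrite !mxE.
by apply: eq_bigr => l _; rewrite !mxE.
Qed.

Lemma mulmx_trE U V i j : (U *m V^T) i j = dotv (row i U) (row j V).
Proof. by rewrite mxE; apply: eq_bigr => k _; rewrite !mxE. Qed.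

Lemma dotext_wedge_rows U V : dotext (wedge_rows U) (wedge_rows V) = \det (U *m V^T).
Proof.
rewrite dotext_wedge; congr (\det _).
by apply/matrixP => i j; rewrite mulmx_trE mxE.
Qed.

Lemma dotextC xi eta : dotext xi eta = dotext eta xi.
Proof. by rewrite /dotext dotvC. Qed.

Lemma dotextZl (a : R) xi eta : dotext (a *: xi) eta = a * dotext xi eta.
Proof. by rewrite /dotext dotvZl mulrCA. Qed.

Lemma dotextZr (a : R) xi eta : dotext xi (a *: eta) = a * dotext xi eta.
Proof. by rewrite dotextC dotextZl dotextC. Qed.

Lemma dotextNl xi eta : dotext (- xi) eta = - dotext xi eta.
Proof. by rewrite -scaleN1r dotextZl mulN1r. Qed.

Lemma dotextNr xi eta : dotext xi (- eta) = - dotext xi eta.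
Proof. by rewrite dotextC dotextNl dotextC. Qed.

Lemma dotext_CauchySchwarz xi eta :
  dotext xi eta ^+ 2 <= dotext xi xi * dotext eta eta.
Proof.
rewrite /dotext exprMn [leRHS]mulrACA -expr2.
apply: ler_wpM2l; rewrite ?sqr_ge0 //; exact: dotv_CauchySchwarz.
Qed.

Lemma dotext_unit_itv xi eta : dotext xi xi = 1 -> dotext eta eta = 1 ->
  -1 <= dotext xi eta <= 1.
Proof.
move=> x1 e1; have := dotext_CauchySchwarz xi eta; rewrite x1 e1 mulr1 => h.
by apply/andP; split; nra.
Qed.

End wedge.

(** The first row is projected off an orthonormal frame V' for the remaining rows. The residue [w]
    is nonzero, since otherwise d+1 independent rows would lie in the span of the d rows of V'. *)
Lemma gram_schmidt (R : realType) (n d : nat) (U : 'M[R]_(d, n)) : row_free U ->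
  exists2 V : 'M[R]_(d, n), V *m V^T = 1%:M & (U <= V)%MS.
Proof.
elim: d U => [|d IH] U.
  by move=> _; exists U => //; apply/matrixP => -[].
rewrite -[d.+1]/(1 + d)%N in U * => freeU.
pose u : 'rV[R]_n := usubmx U; pose U' := dsubmx U.
have UE : U = col_mx u U' by rewrite vsubmxK.
have freeU' : row_free U'.
  apply: inj_row_free => v vU'; pose v0 : 'rV[R]_(1 + d) := row_mx 0 v.
  have : v0 *m col_mx u U' = 0 *m col_mx u U'.
    by rewrite /v0 mul_row_col vU' !mul0mx add0r.
  move=> /row_free_inj; rewrite -UE => /(_ freeU) /(congr1 rsubmx).
  by rewrite row_mxKr => ->; apply/rowP => i; rewrite !mxE.
have [V' oV' UV'] := IH _ freeU'.
pose w := u - u *m V'^T *m V'.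
have w0 : w != 0.
  apply/negP => /eqP/subr0_eq uE; have : (U <= V')%MS.
    by rewrite UE col_mx_sub UV' andbT uE submxMl.
  move=> /mxrankS; rewrite (eqP freeU) leqNgt ltnS => /negP; apply.
  exact: rank_leq_row.
have wV' : w *m V'^T = 0.
  by rewrite mulmxBl -!mulmxA oV' mulmx1 subrr.
have ww : 0 < dotv w w by rewrite lt_neqAle eq_sym dotv_eq0 w0 dotv_ge0.
pose v := (enorm w)^-1 *: w.
have ew0 : enorm w != 0 by rewrite -sqrf_eq0 sqr_enorm gt_eqF.
exists (col_mx v V').
  have vV' : v *m V'^T = 0 by rewrite -scalemxAl wV' scaler0.
  rewrite tr_col_mx mul_col_row oV' vV' -[V' *m v^T]trmxK trmx_mul trmxK vV' trmx0.
  rewrite (_ : v *m v^T = 1%:M) -?scalar_mx_block //.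
  apply/matrixP => i j; rewrite !ord1 [RHS]mxE -dotv_mulmx dotvZl dotvZr mulrA.
  by rewrite -invfM -expr2 sqr_enorm mulVf // gt_eqF.
rewrite UE col_mx_sub (submx_trans UV') ?andbT; last first.
  by rewrite -addsmxE addsmxSr.
rewrite -[u](subrK (u *m V'^T *m V')) -/w addmx_sub //.
  apply: (@submx_trans _ _ _ _ _ _ v); last by rewrite -addsmxE addsmxSl.
  by rewrite -[X in (X <= _)%MS](scalerKV ew0) scalemx_sub.
by apply: (@submx_trans _ _ _ _ _ _ V'); rewrite ?submxMl // -addsmxE addsmxSr.
Qed.

Section oriented_planes.
Context (R : realType) (n d : nat).
Implicit Types (U V : 'M[R]_(d, n)) (xi : extpow R n d).

(** After orthonormalisation the scalar in front of the wedge product has square 1 by the unit norm.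
    Both signs must be listed: for d = 0 the only frame is empty and yields 1 alone. *)
Lemma oriented_planesP xi : oriented_planes xi <->
  exists U, U *m U^T = 1%:M /\ (xi = wedge_rows U \/ xi = - wedge_rows U).
Proof.
split.
  move=> [xi1 [P [u /andP[_ /freeP ufree] [c xiE]]]].
  pose M := \matrix_(i < d) tnth u i.
  have wM : wedgev (tnth u) = wedge_rows M.
    apply/rowP => k; rewrite !mxE; congr (\det _).
    by apply/matrixP => i j; rewrite !mxE.
  have freeM : row_free M.
    apply: inj_row_free => v vM; apply/rowP => i; rewrite mxE.
    apply: (ufree (v 0)); rewrite -[RHS]vM mulmx_sum_row.
    by apply: eq_bigr => j _; rewrite rowK (tnth_nth 0).
  have [V oV /submxP[A MA]] := gram_schmidt freeM.
  exists V; split => //; move: xi1.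
  rewrite xiE wM MA wedge_rows_mulmx scalerA; set b := c * _.
  rewrite dotextZl dotextZr dotext_wedge_rows oV det1 mulr1 => /eqP.
  rewrite -expr2 sqrf_eq1 => /orP[]/eqP->; [left|right];
    by rewrite ?scale1r ?scaleN1r.
move=> [U [oU xiE]].
have freeU : row_free U.
  by apply/row_freeP; exists U^T.
pose u : d.-tuple 'rV[R]_n := [tuple row i U | i < d].
have wU : wedge_rows U = wedgev (tnth u).
  apply/rowP => k; rewrite !mxE; congr (\det _).
  by apply/matrixP => i j; rewrite !mxE tnth_mktuple mxE.
split.
  by case: xiE => ->; rewrite ?dotextNl ?dotextNr ?opprK dotext_wedge_rows oU det1.
exists <<u>>%VS; exists u; last first.
  by case: xiE => ->; rewrite wU; [exists 1; rewrite scale1r|exists (-1); rewrite scaleN1r].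
rewrite /basis_of eqxx; apply/freeP => k k0 i.
have /(row_free_inj freeU) /rowP/(_ i) : (\row_j k j) *m U = 0 *m U.
  rewrite mul0mx -[RHS]k0 mulmx_sum_row; apply: eq_bigr => j _.
  by rewrite mxE -tnth_nth tnth_mktuple.
by rewrite !mxE.
Qed.

Lemma oriented_planesN xi : oriented_planes xi -> oriented_planes (- xi).
Proof.
move=> /oriented_planesP[U [oU xiE]]; apply/oriented_planesP; exists U.
by split => //; case: xiE => ->; rewrite ?opprK; [right|left].
Qed.

Lemma wedge_rows_oriented_planes U : \det (U *m U^T) != 0 ->
  exists2 c : R, c != 0 & oriented_planes (c *: wedge_rows U).
Proof.
move=> U0; have freeU : row_free U.
  apply/row_freeP; exists (U^T *m invmx (U *m U^T)).
  by rewrite mulmxA mulmxV // unitmxE unitfE.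
have [V oV /submxP[A UA]] := gram_schmidt freeU.
have A0 : \det A != 0.
  apply: contraNneq U0 => A0; rewrite UA trmx_mul mulmxA -(mulmxA A) oV mulmx1.
  by rewrite det_mulmx A0 mul0r.
exists (\det A)^-1; first by rewrite invr_eq0.
apply/oriented_planesP; exists V; split => //; left.
by rewrite UA wedge_rows_mulmx scalerA mulVf // scale1r.
Qed.

(* If the planes of xi and eta differ, some w is orthogonal to the first but
   not to the second; replacing a suitable element of an orthonormal basis of
   the second plane by w gives a plane as required. *)
Lemma oriented_planes_separate xi eta :
  oriented_planes xi -> oriented_planes eta -> eta <> xi -> eta <> - xi ->
  exists2 zeta, oriented_planes zeta & dotext zeta xi = 0 /\ dotext zeta eta != 0.
Proof.
move=> /oriented_planesP[U [oU xiE]] /oriented_planesP[V [oV etaE]] ne neN.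
have [/submxP[A VA]|VU] := boolP (V <= U)%MS.
  (* Here V = A U with det A = 1 or -1, so [eta] would be [xi] or its opposite. *)
  exfalso; have := dotext_wedge_rows V V.
  rewrite oV det1 VA wedge_rows_mulmx dotextZl dotextZr dotext_wedge_rows oU det1.
  rewrite mulr1 => /eqP; rewrite -expr2 sqrf_eq1 => /orP[]/eqP A1;
  move: etaE; rewrite VA wedge_rows_mulmx A1 ?scaleN1r ?scale1r ?opprK;
  by case: xiE ne neN => ->; rewrite ?opprK => ? ? [].
have [i /rV0Pn [j Vij]] : exists i, row i V *m cokermx U != 0.
  apply/existsP; rewrite -negb_forall; apply: contra VU => /forallP h.
  rewrite submxE; apply/eqP/row_matrixP => i; rewrite row_mul row0.
  exact/eqP.
(* The columns of [cokermx U] are orthogonal to every row of U; column j is chosen not to be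
   orthogonal to row i of V. *)
pose w : 'rV[R]_n := (col j (cokermx U))^T.
have Uw : U *m w^T = 0 by rewrite trmxK colE mulmxA mulmx_coker mul0mx.
have Vw : dotv (row i V) w != 0.
  apply: contraNneq Vij => /eqP; rewrite dotv_mulmx trmxK colE mulmxA -colE mxE.
  by move=> /eqP ->.
pose V' := \matrix_k (if k == i then w else row k V).
have VV k l : dotv (row k V) (row l V) = (k == l)%:R by rewrite -mulmx_trE oV mxE.
(* V' V^T is the identity matrix except in row i, so its determinant is its i-th diagonal entry. *)
have V'V : \det (V' *m V^T) = dotv (row i V) w.
  rewrite (expand_det_col _ i) (bigD1 i) //= big1 => [|k ki]; last first.
    by rewrite mulmx_trE rowK (negbTE ki) VV (negbTE ki) mul0r.
  rewrite addr0 (_ : cofactor _ _ _ = 1) ?mulr1.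
    by rewrite mulmx_trE rowK eqxx dotvC.
  rewrite /cofactor -signr_odd oddD addbb mul1r -[RHS](det1 R d.-1); congr (\det _).
  apply/matrixP => k l; rewrite 2![LHS]mxE mulmx_trE rowK eq_sym.
  by rewrite (negbTE (neq_lift _ _)) VV (inj_eq lift_inj) mxE.
(* Were the Gram determinant of V' zero, Cauchy-Schwarz would make its product with V vanish. *)
have [|c c0 cV'] := @wedge_rows_oriented_planes V'.
  apply/negP => /eqP V'0.
  have := dotext_CauchySchwarz (wedge_rows V') (wedge_rows V).
  rewrite !dotext_wedge_rows V'0 mul0r V'V => h.
  by move: Vw; rewrite -sqrf_eq0 eq_le h sqr_ge0.
exists (c *: wedge_rows V') => //; split.
  have : dotext (wedge_rows V') (wedge_rows U) = 0.
    rewrite dotext_wedge_rows (expand_det_row _ i) big1 // => k _.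
    rewrite mulmx_trE rowK eqxx dotvC dotv_mulmx -row_mul Uw.
    by rewrite !mxE mul0r.
  by case: xiE => -> h; rewrite ?dotextNr dotextZl h mulr0 ?oppr0.
have : dotext (wedge_rows V') (wedge_rows V) != 0 by rewrite dotext_wedge_rows V'V.
by case: etaE => -> h; rewrite ?dotextNr dotextZl ?oppr_eq0 mulf_neq0.
Qed.

Lemma oriented_planes_gamma_inj (gamma : R -> R) :
  (forall t, -1 <= t <= 1 -> t != 0 -> gamma t <> gamma (- t)) ->
  forall xi eta, oriented_planes xi -> oriented_planes eta ->
  (forall zeta, oriented_planes zeta -> gamma (dotext zeta xi) = gamma (dotext zeta eta)) ->
  xi = eta.
Proof.
move=> gammaN xi eta pxi peta geq; apply/eqP; apply: contraT => /eqP xe.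
have xi1 : dotext xi xi = 1 by case: pxi.
have eta1 : dotext eta eta = 1 by case: peta.
have [exN|exN] := pselect (eta = - xi).
  exfalso; apply: (gammaN 1); [by apply/andP; split; lra|exact: oner_neq0|].
  by have := geq _ pxi; rewrite exN dotextNr xi1.
have [|zeta pzeta [zx ze]] := oriented_planes_separate pxi peta _ exN.
  by move=> h; apply: xe.
exfalso; apply: (gammaN (dotext zeta eta)) => //.
  by apply: dotext_unit_itv => //; case: pzeta.
have := geq _ pzeta; rewrite zx => <-.
by have := geq _ (oriented_planesN pzeta); rewrite !dotextNl zx oppr0.
Qed.

End oriented_planes.

(** * Compactness of the oriented Grassmannian *)

Section topology_lemmas.

Lemma continuous_mul (R : realType) (X : topologicalType) (f g : X -> R) :
  continuous f -> continuous g -> continuous (fun x => f x * g x).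
Proof. by move=> cf cg x; apply: cvgM; [exact: cf|exact: cg]. Qed.

Lemma mx_continuous (R : realType) (X : topologicalType) (m n : nat)
    (f : X -> 'M[R]_(m, n)) :
  (forall i j, continuous (fun x => f x i j)) -> continuous f.
Proof.
move=> fc x A [P Pf PA].
have : \forall y \near x, forall i j, P i j (f y i j).
  apply: filter_forall => i; apply: filter_forall => j.
  exact: (fc i j x _ (Pf i j)).
by apply: filterS => y Py; exact: PA.
Qed.

(** A filter on the subtype is pushed forward along [val]; the cluster point found in A works in the
    subtype, whose open sets are traces of open sets. *)
Lemma compact_set_type (X : topologicalType) (A : set X) :
  compact A -> compact [set: set_type A].
Proof.
move=> cA F FF _; pose G := [set B | F (val @^-1` B)] : set_system X.
have FG : ProperFilter G by exact: fmap_proper_filter.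
have GA : F (val @^-1` A).
  rewrite (_ : _ @^-1` _ = setT); first exact: filterT.
  by apply/seteqP; split => // x _; exact: set_valP.
have [p [Ap clp]] := cA G FG GA; exists (SigSub (mem_set Ap)); split => // B C FB.
rewrite nbhsE => -[D [[E oE ED] Dp] DC].
have Ep : E p by move: Dp; rewrite -ED.
have GB : G (val @` B) by apply: (@filterS _ F _ B) => // x Bx; exists x.
have [_ [[x Bx <-] Ex]] := clp _ _ GB (open_nbhs_nbhs (conj oE Ep)).
by exists x; split => //; apply: DC; rewrite -ED.
Qed.

Lemma separating_sequence (R : realType) (X : pseudoPMetricType R) :
  compact [set: X] -> exists q : nat -> X, forall f : X -> R, continuous f ->
    (forall i, f (q i) = 0) -> forall x, f x = 0.
Proof.
move=> /compact_second_countable[B /countable_injP[g ginj] [oB Bx]].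
exists (fun i => get (get [set U | B U /\ g U = i])) => f fc fq x.
apply: contrapT => /eqP fx0.
have : nbhs x [set y | f y != 0].
  apply: (fc x [set t | t != 0]); apply: open_nbhs_nbhs; split => //.
move=> /Bx[U [BU Ux] Uf].
have UE : get [set U' | B U' /\ g U' = g U] = U.
  have [BU' gU'] := getPex (ex_intro (fun U' => B U' /\ g U' = g U) U (conj BU erefl)).
  by apply: ginj => //; exact/mem_set.
have /Uf /= := getPex (ex_intro U x Ux).
by have := fq (g U); rewrite UE => ->; rewrite eqxx.
Qed.

End topology_lemmas.

Section ograss_topology.
Context (R : realType) (n d : nat).

Lemma wedge_rows_vec_mx_continuous :
  continuous (fun r : 'rV[R]_(d * n) => wedge_rows (vec_mx r)).
Proof.
apply: mx_continuous => i k.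
rewrite (_ : (fun _ => _) = fun s : 'rV[R]_(d * n) => \sum_(p : 'S_d) (-1) ^+ p *
   \prod_a s 0 (mxvec_index a ((enum_val k : {ffun 'I_d -> 'I_n}) (p a)))).
  apply: (continuous_big add_continuous) => p _.
  apply: continuous_mul; first exact: cst_continuous.
  by apply: (continuous_big mul_continuous) => a _; exact: coord_continuous.
by apply/funext => s; rewrite !mxE; apply: eq_bigr => p _; congr (_ * _);
  apply: eq_bigr => a _; rewrite !mxE.
Qed.

(** Frames are flattened to row vectors to apply Heine-Borel. Each entry is at most 1 in absolute
    value because its row has unit norm. *)
Lemma compact_orthonormal :
  compact [set r : 'rV[R]_(d * n) | vec_mx r *m (vec_mx r)^T = 1%:M :> 'M[R]_d].
Proof.
apply: bounded_closed_compact.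
  exists 1; split=> // M M1 r /= or; apply: le_trans (ltW M1).
  rewrite [leLHS]/Num.norm /= mx_normrE; apply/bigmax_leP; split=> // -[i k] _ /=.
  rewrite ord1; case/mxvec_indexP: k => a b.
  have := congr1 (fun M : 'M[R]_d => M a a) or.
  rewrite mulmx_trE [in RHS]mxE eqxx mulr1n => raa.
  have := sqr_coord_le_dotv (row a (vec_mx r)) b; rewrite raa !mxE => h.
  by rewrite ler_norml; apply/andP; split; nra.
rewrite (_ : mkset _ = \bigcap_(ij in [set: 'I_d * 'I_d])
    [set r | dotv (row ij.1 (vec_mx r)) (row ij.2 (vec_mx r)) = (ij.1 == ij.2)%:R]).
  apply: closed_bigI => -[i j] _ /=.
  pose f (r : 'rV[R]_(d * n)) := \sum_k r 0 (mxvec_index i k) * r 0 (mxvec_index j k).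
  have fE r : dotv (row i (vec_mx r)) (row j (vec_mx r)) = f r.
    by apply: eq_bigr => k _; rewrite !mxE.
  under eq_set do rewrite fE.
  apply: (@preimage_closed _ _ f [set x : R | x = (i == j)%:R]); last exact: closed_eq.
  move=> r _; apply: (continuous_big add_continuous) => k _.
  by apply: continuous_mul; exact: coord_continuous.
apply/seteqP; split => r /= h; first by move=> -[i j] _; rewrite /= -mulmx_trE h mxE.
by apply/matrixP => i j; rewrite mulmx_trE (h (i, j) I) mxE.
Qed.

(** The set is the polynomial image of the compact set of orthonormal frames, joined with its
    reflection to obtain both signs. *)
Lemma compact_oriented_planes : compact (@oriented_planes R n d).
Proof.
pose K := [set wedge_rows (vec_mx r) | r in
  [set r : 'rV[R]_(d * n) | vec_mx r *m (vec_mx r)^T = 1%:M :> 'M[R]_d]].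
have cK : compact K.
  apply: continuous_compact compact_orthonormal.
  exact/continuous_subspaceT/wedge_rows_vec_mx_continuous.
rewrite (_ : oriented_planes (d := d) = K `|` [set - x | x in K]).
  apply: compactU => //; apply: continuous_compact => //.
  by apply: continuous_subspaceT; exact: oppr_continuous.
apply/seteqP; split => xi.
  move=> /oriented_planesP[U [oU xiE]].
  have KU : K (wedge_rows U) by exists (mxvec U); rewrite /= mxvecK.
  by case: xiE => ->; [left|right; exists (wedge_rows U)].
by case=> [[r or <-]|[_ [r or <-] <-]]; apply/oriented_planesP; exists (vec_mx r);
  split => //; [left|right].
Qed.

Context (hdn : (d <= n)%N).

Lemma compact_ograss : compact [set: ograss R hdn].
Proof. exact/compact_set_type/compact_oriented_planes. Qed.

Lemma dotext_continuous (zeta : extpow R n d) :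
  continuous (fun xi : ograss R hdn => dotext zeta (val xi)).
Proof.
have dc : continuous (fun eta : extpow R n d => dotext zeta eta).
  apply: continuous_mul; first exact: cst_continuous.
  apply: (continuous_big add_continuous) => k _.
  by apply: continuous_mul; [exact: cst_continuous|exact: coord_continuous].
have vc : continuous (fun xi : ograss R hdn => val xi : extpow R n d).
  exact: initial_continuous.
by move=> xi; exact: (continuous_comp (vc xi) (dc _)).
Qed.

Lemma ograss_dotext_itv (S T : ograss R hdn) : -1 <= dotext (val S) (val T) <= 1.
Proof.
by apply: dotext_unit_itv; [have [] := set_valP S|have [] := set_valP T].
Qed.

(** Continuity of [gamma] within [-1, 1] is enough, as inner products of unit d-vectors stay
    there. *)
Lemma kernel_G_continuous (gamma : R -> R) (S : ograss R hdn) :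
  {within `[-1, 1], continuous gamma} -> continuous (kernel_G gamma S).
Proof.
move=> /subspace_continuousP gc T B hB.
have hT : `[-1, 1]%classic (dotext (val S) (val T)).
  by rewrite /= in_itv; exact: ograss_dotext_itv.
have := dotext_continuous (gc _ hT B hB).
apply: (@filterS _ (nbhs T)) => S'; apply.
by rewrite /= in_itv; exact: ograss_dotext_itv.
Qed.

End ograss_topology.

(** * Density in reproducing kernel Hilbert spaces *)

Section rkhs_density.
Context (R : realType).

(** The discriminant bound, read off at the vertex [b / a]; if a = 0, a nonzero slope contradicts
    positivity at [(e + 1) / b]. *)
Lemma quadratic_ge0_bound (a b e : R) : 0 <= a -> 0 <= e ->
  (forall t, 0 <= t ^+ 2 * a - t * b *+ 2 + e) -> b ^+ 2 <= e * a.
Proof.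
move=> a0 e0 h; have [az|an] := eqVneq a 0; last first.
  have ap : 0 < a by rewrite lt_neqAle eq_sym an a0.
  have := h (b / a); rewrite (_ : _ + e = e - b ^+ 2 / a); last by field.
  by rewrite subr_ge0 ler_pdivrMr.
rewrite az mulr0; have [->|b0] := eqVneq b 0; first by rewrite expr0n.
have := h ((e + 1) / b); rewrite az mulr0 divfK // => h1.
by exfalso; lra.
Qed.

(* A near-minimizer g of the distance from f to V is close to being the
   orthogonal projection of f, and the reproducing property turns the near
   orthogonality of f - g and k z into a pointwise bound. *)
Lemma rkhs_subspace_dense (Z : Type) (k : Z -> Z -> R) (H : rkhs k)
    (V : set (Z -> R)) : V `<=` rkhs_set H -> V (fun=> 0) -> (forall z, V (k z)) ->
  (forall c f g, V f -> V g -> V (fun z => c * f z + g z)) ->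
  forall f e, rkhs_set H f -> 0 < e ->
    exists2 g, V g & forall z, (f z - g z) ^+ 2 <= e * k z z.
Proof.
move=> VH V0 Vk Vlin f e Hf e0; pose q g := rkhs_dot H g g.
(* f - g, written in the shape [c * f + g] of the linearity axioms. *)
pose diff (g : Z -> R) := (fun z => -1 * g z + f z).
have Hdiff g : V g -> rkhs_set H (diff g) by move=> /VH Hg; exact: rkhs_lin.
pose E := [set q (diff g) | g in V].
have infE : has_inf E.
  split; first by exists (q (diff (fun=> 0))), (fun=> 0).
  by exists 0 => _ [g /Hdiff Hg <-]; exact: rkhs_dot_ge0.
have [_ [g Vg <-] gE] := inf_adherent e0 infE; exists g => // z.
have Hk := rkhs_kernel H z.
have qlin c h : rkhs_set H h ->
    rkhs_dot H (fun y => c * k z y + h y) (fun y => c * k z y + h y) =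
    c ^+ 2 * k z z + c * h z *+ 2 + rkhs_dot H h h.
  move=> Hh; have Hg' : rkhs_set H (fun y => c * k z y + h y) by exact: rkhs_lin.
  rewrite rkhs_dot_lin // !(rkhs_dotC _ Hg') // !rkhs_dot_lin //.
  by rewrite (rkhs_dotC Hk Hh) !rkhs_reproducing //; ring.
pose h := diff g; have Hh : rkhs_set H h := Hdiff g Vg.
have -> : f z - g z = h z by rewrite /h /diff mulN1r addrC.
have kk : rkhs_dot H (k z) (k z) = k z z by exact: rkhs_reproducing.
apply: quadratic_ge0_bound (ltW e0) _ => [|t].
  by rewrite -kk; exact: rkhs_dot_ge0.
(* Moving g by [t * k z] changes the squared distance by t^2 k(z, z) - 2 t h(z), which is at least -
   e by the choice of g. *)
pose g' := fun y => t * k z y + g y; have Vg' : V g' by exact: Vlin.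
have g'E : diff g' = fun y => - t * k z y + h y.
  by apply/funext => y; rewrite /h /diff /g'; ring.
have : inf E <= q (diff g') by apply: ge_inf; [case: infE|exists g'].
rewrite /q g'E qlin // => hE.
have hlt : rkhs_dot H h h < inf E + e := gE.
by move: hE hlt; rewrite sqrrN mulNr; lra.
Qed.

(** The subspace density lemma is applied to the kernel of L inside the RKHS, a subspace containing
    every [k z]; this spares any handling of finite combinations. [P] is a domain on which L is
    linear and bounded for the uniform norm. *)
Lemma C0_universal_functional_eq0 (M : topologicalType) (k : M -> M -> R)
    (B C : R) (P : set (M -> R)) (L : (M -> R) -> R) :
  C0_universal k -> (forall z, k z z <= B) -> 
  C0 (R := R) (M := M) `<=` P ->
  (forall c f g, P f -> P g -> P (fun z => c * f z + g z)) ->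
  (forall c f g, P f -> P g -> L (fun z => c * f z + g z) = c * L f + L g) ->
  (forall f s, P f -> (forall z, `|f z| <= s) -> `|L f| <= C * s) ->
  (forall z, L (k z) = 0) ->
  forall f, C0 f -> L f = 0.
Proof.
move=> [H HC0 Hdense] kB C0P Plin Llin Lbd Lk.
have L0 f : P f -> (forall e, 0 < e -> exists g,
    [/\ P g, L g = 0 & forall z, `|f z - g z| <= e]) -> L f = 0.
  move=> Pf fapp; apply/eqP; rewrite -normr_le0; apply/ler_addgt0Pr => e e0.
  have C1 : 0 < `|C| + 1 by rewrite ltr_wpDl.
  have [|g [Pg Lg fg]] := fapp (e / (`|C| + 1)); first by rewrite divr_gt0.
  have Pd := Plin (-1) g f Pg Pf.
  have := Lbd _ (e / (`|C| + 1)) Pd.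
  rewrite Llin // Lg mulr0 !add0r => h; apply: le_trans (h _) _ => [z|].
    by rewrite mulN1r addrC.
  rewrite mulrCA ler_piMr ?(ltW e0) // ler_pdivrMr // mul1r.
  by apply: le_trans (ler_norm C) _; rewrite lerDl.
have LH f : rkhs_set H f -> L f = 0.
  (* On an empty M, [B] has no sign; every function is then bounded by s = 0, which settles the
     case. *)
  move=> Hf; have [z0|Z0] := pselect (exists z0 : M, True); last first.
    apply: L0 (C0P _ (HC0 _ Hf)) _ => e e0; exists (fun=> 0).
    have -> : (fun=> 0) = f by apply/funext => z; case: Z0; exists z.
    split; [exact: (C0P _ (HC0 _ Hf))| |by move=> z; case: Z0; exists z].
    have Pf := C0P _ (HC0 _ Hf); apply/eqP; rewrite -normr_le0 -(mulr0 C).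
    by apply: Lbd => // z; case: Z0; exists z.
  apply: L0 (C0P _ (HC0 _ Hf)) _ => e e0.
  pose V := [set g | rkhs_set H g /\ L g = 0].
  have VP g : V g -> P g by move=> [/HC0/C0P].
  have kP z : P (k z) by apply/C0P/HC0/rkhs_kernel.
  have V0 : V (fun=> 0).
    case: z0 => z0 _; split; first exact: rkhs_zero.
    rewrite (_ : (fun=> 0) = fun z => -1 * k z0 z + k z0 z).
      by rewrite Llin // Lk mulr0 addr0.
    by apply/funext => z; ring.
  have B0 : 0 <= B.
    case: z0 => z0 _; apply: le_trans (kB z0).
    by rewrite -(rkhs_reproducing z0 (rkhs_kernel H z0)); exact/rkhs_dot_ge0/rkhs_kernel.
  have B1 : 0 < B + 1 by rewrite ltr_wpDl.
  (* With this tolerance the squared error is at most e^2 k(z, z) / (B + 1) <= e^2. *)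
  have eB : 0 < e ^+ 2 / (B + 1) by rewrite divr_gt0 // exprn_gt0.
  have [|//|z|c f1 f2 V1 V2|g Vg fg] := @rkhs_subspace_dense _ k H V _ _ _ _ f _ Hf eB.
  - by move=> g [].
  - by split; [exact: rkhs_kernel|exact: Lk].
  - split; first by case: V1 => ? _; case: V2 => ? _; exact: rkhs_lin.
    rewrite (Llin c _ _ (VP _ V1) (VP _ V2)); case: V1 => _ ->; case: V2 => _ ->.
    by rewrite mulr0 addr0.
  exists g; split; [exact: VP|by case: Vg|] => z.
  rewrite -(@ler_pXn2r _ 2) // ?nnegrE ?(ltW e0) // real_normK ?num_real //.
  apply: le_trans (fg z) _; rewrite -mulrA ler_piMr ?sqr_ge0 // mulrC ler_pdivrMr //.
  by rewrite mul1r; apply: le_trans (kB z) _; rewrite lerDl.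
move=> f fC0; apply: L0 (C0P _ fC0) _ => e e0.
have [g Hg fg] := Hdense f fC0 e e0.
by exists g; split; [exact/C0P/HC0|exact: LH|].
Qed.

End rkhs_density.

(** * Densities with respect to Hausdorff measure *)

Section hausdorff_density.
Context (R : realType) (n d : nat).
Local Notation M := (hausdorff_mspace R n d).
Local Notation mu := (@hausdorff_measure R n d).
Local Open Scope ereal_scope.
Implicit Types (p q : M -> \bar R) (U : set 'rV[R]_n).

(** Integration of p and of q gives two measures on the Borel sets that agree on the open sets, a
    class stable under intersection. As the total mass is finite, the constant sequence [setT] is an
    admissible exhaustion. *)
Lemma borel_integral_unique p q :
  measurable_fun [set: M] p -> measurable_fun [set: M] q ->
  (forall x, 0 <= p x) -> (forall x, 0 <= q x) -> \int[mu]_x p x < +oo ->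
  (forall U, open U -> \int[mu]_(x in (U : set M)) p x = \int[mu]_(x in (U : set M)) q x) ->
  forall B : set (borel 'rV[R]_n), measurable B ->
    \int[mu]_(x in (B : set M)) p x = \int[mu]_(x in (B : set M)) q x.
Proof.
move=> mp mq p0 q0 poo pqU.
pose dens r (B : set (borel 'rV[R]_n)) := \int[mu]_(x in (B : set M)) r x.
have dens0 r : dens r set0 = 0 by exact: integral_set0.
have dens_ge0 r : (forall x, 0 <= r x) -> forall B, 0 <= dens r B.
  by move=> r0 B; apply: integral_ge0.
have dens_sigma r : measurable_fun [set: M] r -> (forall x, 0 <= r x) ->
    semi_sigma_additive (dens r).
  move=> mr r0 F mF tF _; rewrite /dens ge0_integral_bigcup //; last first.
  - exact: measurable_funTS.
  - by move=> k; exact: borel_hausdorff_measurable.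
  by apply: is_cvg_ereal_nneg_natsum => k _; exact: integral_ge0.
pose m1 : {measure set (borel 'rV[R]_n) -> \bar R} := HB.pack (dens p)
  (isMeasure.Build _ _ _ (dens p) (dens0 p) (dens_ge0 p p0) (dens_sigma p mp p0)).
pose m2 : {measure set (borel 'rV[R]_n) -> \bar R} := HB.pack (dens q)
  (isMeasure.Build _ _ _ (dens q) (dens0 q) (dens_ge0 q q0) (dens_sigma q mq q0)).
move=> B mB.
apply: (@measure_unique _ R (borel 'rV[R]_n) (@open 'rV[R]_n) (fun=> setT) _ _ _ _ m1 m2).
- by [].
- by move=> U V; exact: openI.
- by move=> _; exact: openT.
- by rewrite bigcup_const.
- by move=> U oU; exact: pqU.
- by move=> _; exact: poo.
- exact: mB.
Qed.

Lemma integral_eq0_null (A : set M) p : measurable A -> measurable_fun [set: M] p ->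
  (forall x, A x -> 0 < p x) -> \int[mu]_(x in A) p x = 0 -> mu A = 0.
Proof.
move=> mA mp p0 ip0.
have : \int[mu]_(x in A) `|p x| = 0.
  rewrite -[RHS]ip0; apply: eq_integral => x /set_mem Ax.
  by rewrite gee0_abs // ltW // p0.
move=> /(ae_eq_integral_abs _ mA (measurable_funTS mp)) [N [mN N0 AN]].
apply/eqP; rewrite -measure_le0 -N0; apply: le_measure; rewrite ?inE // => x Ax.
by apply: AN => /(_ Ax) px0; have := p0 _ Ax; rewrite px0 ltxx.
Qed.

(** A = {p > 0} need not be Borel, so it is enclosed in a Borel set B with B minus A null. Then the
    integral of p over A is at most that of p over B, equal to that of q over B, which is 0 because
    q vanishes on A. *)
Lemma hausdorff_density_disjoint p q :
  measurable_fun [set: M] p -> measurable_fun [set: M] q ->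
  (forall x, 0 <= p x) -> (forall x, 0 <= q x) ->
  (forall B : set (borel 'rV[R]_n), measurable B ->
    \int[mu]_(x in (B : set M)) p x = \int[mu]_(x in (B : set M)) q x) ->
  (forall x, 0 < p x -> q x = 0) ->
  mu [set x | 0 < p x] < +oo -> mu [set x | 0 < p x] = 0.
Proof.
move=> mp mq p0 q0 pqB pq0 Aoo; set A := mkset _ in Aoo *.
have mA : measurable A.
  rewrite (_ : A = setT `&` [set x | 0 < p x]); last by rewrite setTI.
  exact: emeasurable_fun_o_infty.
have [B [mB AB BA]] := @hausdorff_borel_regular R n d A Aoo.
have mB' := borel_hausdorff_measurable d mB.
have BA0 : mu (B `\` A) = 0.
  rewrite measureD //; last by rewrite [ltLHS]BA.
  rewrite setIC (setIidl AB); apply/eqP; rewrite sube_eq ?add0e.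
  - exact/eqP.
  - by rewrite ge0_fin_numE // [ltLHS]BA.
  - by rewrite fin_num_adde_defr // ge0_fin_numE.
apply: (@integral_eq0_null _ p) => //.
apply/eqP; rewrite eq_le integral_ge0 // andbT.
apply: (@le_trans _ _ (\int[mu]_(x in (B : set M)) p x)).
  by apply: ge0_subset_integral => //; exact: measurable_funTS.
rewrite pqB // (ge0_negligible_integral _ _ _ _ BA0) //; last 2 first.
- exact: measurableD.
- exact: measurable_funTS.
rewrite integral0_eq // => x [Bx /not_andP[//|/contrapT Ax]]; exact: pq0.
Qed.

End hausdorff_density.

(** * Approximation of indicators of open sets by C_0 functions *)

Section indicator_approximation.
Context (R : realType) (n : nat).

Lemma continuous_measurable_hausdorff d (f : 'rV[R]_n -> R) : continuous f ->
  measurable_fun [set: hausdorff_mspace R n d] (f : hausdorff_mspace R n d -> R).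
Proof.
move=> cf; apply: (measurability _ (RGenOpens.measurableE R)).
move=> _ [_ [a [b ->] <-]]; rewrite setTI; apply: open_hausdorff_measurable.
by apply: open_comp => //; exact: interval_open.
Qed.

Lemma C0_bounded (f : 'rV[R]_n -> R) : C0 f -> exists C, forall x, `|f x| <= C.
Proof.
move=> [cf /(_ 1 ltr01) cpt].
have /compact_bounded [C [_ hC]] : compact (f @` [set z | 1 <= `|f z|]).
  by apply: continuous_compact cpt; exact: continuous_subspaceT.
exists (`|C| + 1) => x; have [f1|f1] := leP 1 `|f x|.
  by apply: hC; [apply: le_lt_trans (ler_norm C) _; rewrite ltrDl|exists x].
by apply: le_trans (ltW f1) _; rewrite lerDr.
Qed.

Lemma open_indic_approx (U : set 'rV[R]_n) : open U ->
  exists f : nat -> 'rV[R]_n -> R,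
    [/\ forall k, C0 (f k), forall k x, `|f k x| <= 1
      & forall x, f ^~ x @ \oo --> (\1_U x : R)].
Proof.
move=> oU; have [phi [phiL phi0 phiU]] := open_enorm_distance oU.
(* The first factor increases to the indicator of U; the second is a cutoff, null outside the ball
   of radius k, which gives compact superlevel sets. *)
pose f k x : R := Num.min 1 (k%:R * phi x) * Num.max 0 (Num.min 1 (k%:R - `|x|)).
have f01 k x : 0 <= f k x <= 1.
  have a01 : 0 <= Num.min 1 (k%:R * phi x) <= 1.
    by rewrite le_min ler01 mulr_ge0 //= ge_min lexx.
  have b01 : 0 <= Num.max 0 (Num.min 1 (k%:R - `|x|)) <= 1.
    by rewrite le_max lexx /= ge_max ler01 ge_min lexx.
  by case/andP: a01 => a0 a1; case/andP: b01 => b0 b1; rewrite mulr_ge0 //= mulr_ile1.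
have fc k : continuous (f k).
  have cstc (c : R) : continuous (fun _ : 'rV[R]_n => c) by exact: cst_continuous.
  have phic := enorm_lipschitz_continuous phiL.
  have minc (g : 'rV[R]_n -> R) : continuous g ->
      continuous (fun x : 'rV[R]_n => Num.min 1 (g x) : R).
    by move=> gc x; exact: (continuous_min (cstc 1 x) (gc x)).
  have maxc (g : 'rV[R]_n -> R) : continuous g ->
      continuous (fun x : 'rV[R]_n => Num.max 0 (g x) : R).
    by move=> gc x; exact: (continuous_max (cstc 0 x) (gc x)).
  apply: continuous_mul; [apply/minc/continuous_mul => //|apply/maxc/minc => x].
  exact: (cvgB (cstc k%:R x) (@norm_continuous _ _ x)).
exists f; split => [k|k x|x].
- split => // e e0; apply: bounded_closed_compact.
    exists k%:R; split => // r kr x /= efx; rewrite leNgt; apply/negP => rx.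
    have g0 : Num.min 1 (k%:R - `|x|) <= 0.
      by rewrite ge_min subr_le0 (ltW (lt_trans kr rx)) orbT.
    by move: efx; rewrite /f (max_l g0) mulr0 normr0 leNgt e0.
  apply: (@preimage_closed _ _ (fun x => `|f k x|) [set t | e <= t]).
    by move=> x _; apply: continuous_comp; [exact: fc|exact: norm_continuous].
  exact: closed_ge.
- by have /andP[f0 f1] := f01 k x; rewrite ger0_norm.
apply: cvg_near_cst; rewrite indicE; case: (boolP (x \in U)) => xU; last first.
  have px0 : phi x = 0.
    apply/eqP; rewrite eq_le phi0 andbT leNgt; apply/negP => /phiU Ux.
    by move: xU; rewrite notin_setE.
  by apply: nearW => k; rewrite /f px0 mulr0 min_r ?mul0r ?ler01.
have px : 0 < phi x by apply/phiU; exact/set_mem.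
near=> k; rewrite /f !min_l ?max_r ?mulr1 //.
- rewrite lerBrDr; near: k; exact: nbhs_infty_ger.
- rewrite -ler_pdivrMr //; near: k; exact: nbhs_infty_ger.
Unshelve. all: by end_near. Qed.

End indicator_approximation.

(** * Separation of densities by C_0 test functions *)

Section test_functions.
Context (R : realType) (n d : nat).
Local Notation M := (hausdorff_mspace R n d).
Local Notation mu := (@hausdorff_measure R n d).
Implicit Types (f : 'rV[R]_n -> R) (U : set 'rV[R]_n).

Lemma bounded_integrable_hausdorff (X : set M) (a : M -> R) (C : R) :
  measurable X -> (mu X < +oo)%E -> measurable_fun X a ->
  (forall x, X x -> `|a x| <= C) -> mu.-integrable X (EFin \o a).
Proof.
move=> mX Xoo ma aC; apply: measurable_bounded_integrable => //.
exists C; split; first exact: num_real.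
by move=> y Cy x Xx; apply: le_trans (ltW Cy); exact: aC.
Qed.

(** Dominated convergence along the approximations of the indicator, with |g| as the bound. *)
Lemma open_integral_eq0 (g : M -> R) : mu.-integrable [set: M] (EFin \o g) ->
  (forall f, C0 f -> (\int[mu]_x (f x * g x)%:E = 0)%E) ->
  forall U, open U -> (\int[mu]_(x in (U : set M)) (g x)%:E = 0)%E.
Proof.
move=> ig fg U oU; have [f [fC0 f1 fU]] := open_indic_approx oU.
have mg : measurable_fun [set: M] g by apply/measurable_EFinP; exact: measurable_int ig.
have mU : measurable (U : set M) by exact: open_hausdorff_measurable.
have -> : (\int[mu]_(x in (U : set M)) (g x)%:E = \int[mu]_x (\1_U x * g x)%:E)%E.
  rewrite integral_mkcond; apply: eq_integral => x _.
  by rewrite patchE indicE; case: ifP => xU; rewrite ?mul1r ?mul0r.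
have mf k : measurable_fun [set: M] (fun x => (f k x * g x)%:E).
  apply/measurable_EFinP/measurable_funM => //.
  by apply: continuous_measurable_hausdorff; case: (fC0 k).
have mUg : measurable_fun [set: M] (fun x => (\1_U x * g x)%:E).
  by apply/measurable_EFinP/measurable_funM => //; exact: measurable_indic.
have cvgU : {ae mu, forall x, [set: M] x ->
    (f k x * g x)%:E @[k --> \oo] --> (\1_U x * g x)%:E}.
  apply: aeW => x _; apply: cvg_EFin; first exact: nearW.
  by apply: cvgM; [exact: fU|exact: cvg_cst].
have domg : {ae mu, forall x k, [set: M] x -> (`|(f k x * g x)%:E| <= `|g x|%:E)%E}.
  by apply: aeW => x k _; rewrite lee_fin normrM ler_piMl.
have [_ _ dcv] := dominated_convergence measurableT mf mUg cvgU (integrable_abse ig) domg.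
apply: cvg_unique dcv _ => //=.
by under eq_fun do rewrite fg //; exact: cvg_cst.
Qed.

(** The positive and negative parts of the difference [g] have equal integrals over open sets and
    disjoint supports inside the union of X and Y. The lemma on disjoint densities, used in both
    orders, makes both supports null. *)
Lemma hausdorff_C0_separating (X Y : set M) (a b : M -> R) (C : R) :
  measurable X -> measurable Y -> (mu X < +oo)%E -> (mu Y < +oo)%E ->
  measurable_fun X a -> measurable_fun Y b ->
  (forall x, `|a x| <= C) -> (forall x, `|b x| <= C) ->
  (forall f, C0 f -> \int[mu]_(x in X) (f x * a x) = \int[mu]_(x in Y) (f x * b x)) ->
  mu [set x | (a \_ X) x != (b \_ Y) x] = 0%E.
Proof.
move=> mX mY Xoo Yoo ma mb aC bC fab; pose g : M -> R := (a \_ X) \- (b \_ Y).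
have ia := bounded_integrable_hausdorff mX Xoo ma (fun x _ => aC x).
have ib := bounded_integrable_hausdorff mY Yoo mb (fun x _ => bC x).
have ig : mu.-integrable [set: M] (EFin \o g).
  have := integrableB measurableT (iffLR (integrable_mkcond _ mX) ia)
    (iffLR (integrable_mkcond _ mY) ib).
  by rewrite !restrict_EFin.
have fg f : C0 f -> (\int[mu]_x (f x * g x)%:E = 0)%E.
  move=> fC0; have [D fD] := C0_bounded fC0.
  have mf := @continuous_measurable_hausdorff R n d f (proj1 fC0).
  have bd (c : M -> R) : (forall x, `|c x| <= C) -> forall x, `|f x * c x| <= D * C.
    by move=> cC x; rewrite normrM ler_pM.
  have ifa := bounded_integrable_hausdorff mX Xoo
    (measurable_funM (measurable_funTS mf) ma) (fun x _ => bd a aC x).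
  have ifb := bounded_integrable_hausdorff mY Yoo
    (measurable_funM (measurable_funTS mf) mb) (fun x _ => bd b bC x).
  transitivity (\int[mu]_x (((EFin \o (f \* a)%R) \_ X) x - ((EFin \o (f \* b)%R) \_ Y) x))%E.
    apply: eq_integral => x _; rewrite /g /= !patchE.
    by case: ifP => _; case: ifP => _; rewrite -?EFinB mulrBr ?mulr0.
  rewrite (integralB measurableT (iffLR (integrable_mkcond _ mX) ifa)
    (iffLR (integrable_mkcond _ mY) ifb)).
  rewrite -!integral_mkcond -(fineK (integrable_fin_num mX ifa)).
  rewrite -(fineK (integrable_fin_num mY ifb)) -EFinB.
  by have := fab f fC0; rewrite /Rintegral => ->; rewrite subrr.
have gU := open_integral_eq0 ig fg.
pose p := (EFin \o g)^\+%E; pose q := (EFin \o g)^\-%E.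
have ip : mu.-integrable [set: M] p by exact: integrable_funepos.
have iq : mu.-integrable [set: M] q by exact: integrable_funeneg.
have mp := measurable_int _ ip; have mq := measurable_int _ iq.
have p0 x : (0 <= p x)%E by exact: funepos_ge0.
have q0 x : (0 <= q x)%E by exact: funeneg_ge0.
have pqU U : open U ->
    (\int[mu]_(x in (U : set M)) p x = \int[mu]_(x in (U : set M)) q x)%E.
  move=> oU; have mU := open_hausdorff_measurable d oU.
  have := gU _ oU; rewrite integralE => pq.
  have fq := integrable_fin_num mU (integrableS measurableT mU (@subsetT _ _) iq).
  by rewrite -[LHS](subeK _ fq) [X in (X + _)%E]pq add0e.
have pE x : p x = (Num.max (g x) 0)%:E by rewrite /p funeposE EFin_max.
have qE x : q x = (Num.max (- g x) 0)%:E by rewrite /q funenegE EFin_max.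
have XYoo : (mu (X `|` Y) < +oo)%E.
  by apply: le_lt_trans (outer_measureU2 (@hausdorff R n d) X Y) _; rewrite lte_add_pinfty.
have gXY x : g x != 0 -> (X `|` Y) x.
  apply: contraPP => /not_orP[nX nY]; apply/negP; rewrite negbK /g /= !patchE.
  by rewrite !memNset // subrr.
have null (r : M -> \bar R) : measurable_fun [set: M] r ->
    (forall x, (0 < r x)%E -> g x != 0) -> (mu [set x | 0 < r x] < +oo)%E.
  move=> mr rg; apply: le_lt_trans XYoo; apply: le_measure; rewrite ?inE.
  - rewrite (_ : mkset _ = setT `&` [set x | 0 < r x])%E; last by rewrite setTI.
    exact: emeasurable_fun_o_infty.
  - exact: measurableU.
  - by move=> x /rg/gXY.
have p_null : mu [set x | 0 < p x]%E = 0%E.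
  apply: (hausdorff_density_disjoint mp mq p0 q0).
  - apply: borel_integral_unique => //; exact: integral_funepos_lt_pinfty ig.
  - by move=> x; rewrite pE qE lte_fin lt_max ltxx orbF => gx; rewrite max_r // oppr_le0 ltW.
  - by apply: null => // x; rewrite pE lte_fin lt_max ltxx orbF => /lt0r_neq0.
have q_null : mu [set x | 0 < q x]%E = 0%E.
  apply: (hausdorff_density_disjoint mq mp q0 p0).
  - move=> B mB; apply/esym; move: B mB.
    apply: borel_integral_unique => //; exact: integral_funepos_lt_pinfty ig.
  - by move=> x; rewrite pE qE lte_fin lt_max ltxx orbF oppr_gt0 => gx; rewrite max_r // ltW.
  - by apply: null => // x; rewrite qE lte_fin lt_max ltxx orbF oppr_gt0 => /ltr0_neq0.
apply/eqP; rewrite eq_le outer_measure_ge0 andbT.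
apply: (@le_trans _ _ (mu [set x | 0 < p x]%E + mu [set x | 0 < q x]%E)%E); last first.
  by rewrite p_null q_null adde0.
apply: le_trans (outer_measureU2 (@hausdorff R n d) _ _); apply: le_hausdorff => x /=.
rewrite -subr_eq0 -/(g x) neq_lt pE qE !lte_fin !lt_max ltxx !orbF oppr_gt0 => /orP[] gx;
by [right|left].
Qed.

End test_functions.

(** * Kernels and varifolds *)

Section kernels.
Context (R : realType).

(** Positivity at the two points with weights 1 and c, for c = 1 and c = -1. *)
Lemma positive_definite_kernel_bound (Z : Type) (k : Z -> Z -> R) (B : R) :
  positive_definite_kernel k -> (forall z, k z z = B) -> forall z z', `|k z z'| <= B.
Proof.
move=> [kC kpd] kB z z'.
have h c : c ^+ 2 = 1 -> 0 <= B + c * k z z' *+ 2 + B.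
  move=> c2; pose zz (i : 'I_2) := if i == ord0 then z else z'.
  pose cc (i : 'I_2) : R := if i == ord0 then 1 else c.
  have := kpd 2 zz cc; rewrite !big_ord_recl !big_ord0 /zz /cc /=.
  rewrite !kB (kC z' z) -[c * c]expr2 c2; lra.
have h1 := h 1 (expr1n _ _); have h2 := h (-1) (sqrr_sign _ 1).
rewrite ler_norml; apply/andP; split; [move: h1|move: h2]; lra.
Qed.

Lemma C0_prod (X Y : topologicalType) (f : X -> R) (h : Y -> R) (D : R) :
  compact [set: Y] -> C0 f -> continuous h -> (forall y, `|h y| <= D) ->
  C0 (fun z : X * Y => f z.1 * h z.2).
Proof.
move=> cY [fc fcpt] hc hD.
have cont : continuous (fun z : X * Y => f z.1 * h z.2).
  by apply: continuous_mul => z; apply: continuous_comp;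
    [exact: cvg_fst|exact: fc|exact: cvg_snd|exact: hc].
split => // e e0; have D1 : 0 < `|D| + 1 by rewrite ltr_wpDl.
(* |f h| >= e forces |f| >= e / (|D| + 1), a compact condition on the first factor; the second is
   compact by assumption. *)
apply: (@subclosed_compact _ _ ([set x | e / (`|D| + 1) <= `|f x|] `*` [set: Y])).
- apply: (@preimage_closed _ _ (fun z => `|f z.1 * h z.2|) [set t | e <= t]).
    move=> z _; apply: (@continuous_comp _ _ _ (fun z : X * Y => f z.1 * h z.2)).
      exact: cont.
    exact: norm_continuous.
  exact: closed_ge.
- by apply: compact_setX => //; apply: fcpt; rewrite divr_gt0.
- move=> [x y] /= efh; split => //=; rewrite ler_pdivrMr //.
  apply: le_trans efh _; rewrite normrM ler_wpM2l //.
  by apply: le_trans (hD y) _; apply: le_trans (ler_norm D) _; rewrite lerDl.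
Qed.

(** [L] is an arbitrary map, without homogeneity, so only a multiple of [k z] lying in the unit ball
    can be tested. The factor 1 / (1 + k(z, z)) achieves this even when k(z, z) = 0. *)
Lemma dual_norm_eq0 (Z : Type) (k : Z -> Z -> R) (W : rkhs k) (L : (Z -> R) -> R) :
  dual_norm W L = 0%E -> forall z, exists2 c, 0 < c & L (fun z' => c * k z z') = 0.
Proof.
move=> L0 z; have Hk := rkhs_kernel W z.
have kk : rkhs_dot W (k z) (k z) = k z z by exact: rkhs_reproducing.
have k0 : 0 <= k z z by rewrite -kk; exact: rkhs_dot_ge0.
have k1 : 0 < 1 + k z z by rewrite ltr_pwDl.
exists (1 + k z z)^-1; first by rewrite invr_gt0.
set c := _^-1; pose w := fun z' => c * k z z' + 0.
have Hw : rkhs_set W w by apply: (rkhs_lin _ Hk); exact: rkhs_zero.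
have dot0 h : rkhs_set W h -> rkhs_dot W (fun=> 0) h = 0.
  move=> Hh; have := @rkhs_dot_lin _ _ _ W (-1) _ _ _ Hk Hk Hh.
  by rewrite mulN1r addNr; under eq_fun do rewrite mulN1r addNr.
have ww : rkhs_dot W w w = c ^+ 2 * k z z.
  rewrite /w rkhs_dot_lin ?dot0 ?addr0 //; last exact: rkhs_zero.
  rewrite rkhs_dotC // rkhs_dot_lin ?dot0 ?addr0 ?kk //; last exact: rkhs_zero.
  by rewrite mulrA expr2.
have -> : (fun z' => c * k z z') = w by apply/funext => z'; rewrite /w addr0.
suff : (`|L w|%:E <= dual_norm W L)%E by rewrite L0 lee_fin normr_le0 => /eqP.
apply: ereal_sup_ubound; exists w => //.
split => //; rewrite /dot_norm ww -sqrtr1 ler_wsqrtr //.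
rewrite /c exprVn mulrC ler_pdivrMr ?exprn_gt0 // mul1r; nra.
Qed.

End kernels.

(** * Slices of varifolds at a fixed oriented plane *)

Section varifolds.
Context (R : realType) (n d : nat) (hdn : (d <= n)%N).
Local Notation M := (hausdorff_mspace R n d).
Local Notation mu := (@hausdorff_measure R n d).

Lemma measurable_kernel_G (gamma : R -> R) (T0 : ograss R hdn) (X : set M)
    (T : 'rV[R]_n -> ograss R hdn) : {within `[-1, 1], continuous gamma} ->
  measurable_fun X (T : M -> borel (ograss R hdn)) ->
  measurable_fun X ((fun y => kernel_G gamma T0 (T y)) : M -> R).
Proof.
move=> gc mT mX; apply: (measurability _ (RGenOpens.measurableE R)) => //.
move=> _ [_ [a [b ->] <-]].
apply: (mT mX (kernel_G gamma T0 @^-1` `]a, b[)); apply: sub_sigma_algebra.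
by apply: open_comp => [y _|]; [exact: kernel_G_continuous|exact: interval_open].
Qed.

Lemma kernel_G_bound (gamma : R -> R) : positive_definite_kernel (@kernel_G R n d hdn gamma) ->
  forall T0 T1 : ograss R hdn, `|kernel_G gamma T0 T1| <= gamma 1.
Proof.
move=> /positive_definite_kernel_bound; apply => T0.
by rewrite /kernel_G; have [-> _] := set_valP T0.
Qed.

Lemma kernel_posxx (rho : R -> R) (x : 'rV[R]_n) : kernel_pos rho x x = rho 0.
Proof. by rewrite /kernel_pos subrr enorm0 expr0n. Qed.

Lemma bounded_Rintegral (X : set M) (a : M -> R) (C : R) :
  measurable X -> (mu X < +oo)%E -> measurable_fun X a ->
  (forall x, `|a x| <= C) -> `|\int[mu]_(x in X) a x| <= C * fine (mu X).
Proof.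
move=> mX Xoo ma aC; have ia := bounded_integrable_hausdorff mX Xoo ma (fun x _ => aC x).
apply: le_trans (le_normr_Rintegral mX ia) _; rewrite -Rintegral_cst //.
apply: le_Rintegral => //; first exact: integrable_norm.
by apply: (@bounded_integrable_hausdorff _ _ _ _ _ `|C|) => // x _; exact: lexx.
Qed.

Lemma varifold_slice_null (rho gamma : R -> R)
    (W : rkhs (@kernel_prod R n d hdn rho gamma)) (X Y : set M)
    (T S : 'rV[R]_n -> ograss R hdn) (muX muY : oriented_varifold R hdn)
    (T0 : ograss R hdn) :
  {within `[-1, 1], continuous gamma} ->
  positive_definite_kernel (@kernel_G R n d hdn gamma) ->
  (forall x : 'rV[R]_n, C0 (kernel_pos rho x)) ->
  C0_universal (@kernel_pos R n rho) ->
  measurable X -> measurable Y -> (mu X < +oo)%E -> (mu Y < +oo)%E ->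
  measurable_fun X (T : M -> borel (ograss R hdn)) ->
  measurable_fun Y (S : M -> borel (ograss R hdn)) ->
  associated_varifold X T muX -> associated_varifold Y S muY ->
  dual_norm W (fun w => pairing muX w - pairing muY w) = 0%E ->
  mu [set y | ((fun y => kernel_G gamma T0 (T y)) \_ X) y !=
              ((fun y => kernel_G gamma T0 (S y)) \_ Y) y] = 0%E.
Proof.
move=> gc kGpd kC0 kuniv mX mY Xoo Yoo mT mS assX assY dist0.
pose a y := kernel_G gamma T0 (T y); pose b y := kernel_G gamma T0 (S y).
have kGb := kernel_G_bound kGpd.
have ma : measurable_fun X (a : M -> R) := measurable_kernel_G T0 gc mT.
have mb : measurable_fun Y (b : M -> R) := measurable_kernel_G T0 gc mS.
(* Bounded continuous functions contain C_0, are stable under combinations, and are integrable on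
   sets of finite mass. *)
pose P : set ('rV[R]_n -> R) := [set f | continuous f /\ exists C, forall x, `|f x| <= C].
have C0P f : C0 f -> P f by move=> fC0; split; [case: fC0|exact: C0_bounded].
have mf (Z : set M) (c : M -> R) (f : 'rV[R]_n -> R) : measurable_fun Z c -> continuous f ->
    measurable_fun Z (fun y : M => f y * c y).
  move=> mc fc; apply: measurable_funM => //.
  exact/measurable_funTS/continuous_measurable_hausdorff.
have fb (c : M -> R) (f : 'rV[R]_n -> R) s :
    (forall y, `|c y| <= gamma 1) -> (forall y, `|f y| <= s) ->
    forall y, `|f y * c y| <= s * gamma 1.
  by move=> cb fs y; rewrite normrM ler_pM.
have intP (Z : set M) (c : M -> R) (f : 'rV[R]_n -> R) : measurable Z -> (mu Z < +oo)%E ->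
    measurable_fun Z c -> (forall y, `|c y| <= gamma 1) -> P f ->
    mu.-integrable Z (EFin \o (fun y : M => f y * c y)).
  move=> mZ Zoo mc cb [fc [s fs]].
  exact: (bounded_integrable_hausdorff mZ Zoo (mf _ _ _ mc fc) (fun y _ => fb _ _ _ cb fs y)).
have lin (Z : set M) (c : M -> R) : measurable Z -> (mu Z < +oo)%E ->
    measurable_fun Z c -> (forall y, `|c y| <= gamma 1) ->
    forall r (f g : 'rV[R]_n -> R), P f -> P g ->
    \int[mu]_(y in Z) ((r * f y + g y) * c y) =
    r * \int[mu]_(y in Z) (f y * c y) + \int[mu]_(y in Z) (g y * c y).
  move=> mZ Zoo mc cb r f g Pf Pg.
  have i1 := intP _ _ _ mZ Zoo mc cb Pf; have i2 := intP _ _ _ mZ Zoo mc cb Pg.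
  rewrite -RintegralZl // -RintegralD //.
    by apply: eq_Rintegral => y _; ring.
  by have := integrableZl mZ r i1; apply: eq_integrable.
pose L (f : 'rV[R]_n -> R) := \int[mu]_(y in X) (f y * a y) - \int[mu]_(y in Y) (f y * b y).
have aB y : `|a y| <= gamma 1 by exact: kGb.
have bB y : `|b y| <= gamma 1 by exact: kGb.
apply: (@hausdorff_C0_separating _ _ _ X Y a b (gamma 1)) => // f fC0.
apply/eqP; rewrite -subr_eq0 -/(L f); apply/eqP.
apply: (C0_universal_functional_eq0 (P := P) (B := rho 0)
  (C := gamma 1 * (fine (mu X) + fine (mu Y))) kuniv _ C0P) => //.
- by move=> z; rewrite kernel_posxx.
- move=> c f1 f2 [f1c [s1 f1s]] [f2c [s2 f2s]]; split.
    move=> x; apply: (cvgD _ (f2c x)); apply: continuous_mul => //.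
    exact: cst_continuous.
  exists (`|c| * s1 + s2) => x; apply: le_trans (ler_normD _ _) _.
  by rewrite normrM lerD // ler_wpM2l.
- by move=> c f1 f2 P1 P2; rewrite /L !lin //; ring.
- move=> g s [gcont _] gs; apply: le_trans (ler_normB _ _) _.
  have := bounded_Rintegral mX Xoo (mf _ _ _ ma gcont) (fb _ _ _ aB gs).
  have := bounded_Rintegral mY Yoo (mf _ _ _ mb gcont) (fb _ _ _ bB gs).
  move=> h1 h2; apply: le_trans (lerD h2 h1) _.
  by rewrite -mulrDr -[leLHS]mulrA [leLHS]mulrC.
move=> x; have [c c0] := dual_norm_eq0 dist0 (x, T0).
(* The factor [c] is absorbed into the plane variable, which leaves a product of a C_0 function and
   a bounded one. *)
have -> : (fun z' => c * kernel_prod rho gamma (x, T0) z') =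
    (fun z' => kernel_pos rho x z'.1 * (c * kernel_G gamma T0 z'.2)).
  by apply/funext => z'; rewrite /kernel_prod /=; ring.
have wC0 : C0 (fun z' : 'rV[R]_n * ograss R hdn =>
    kernel_pos rho x z'.1 * (c * kernel_G gamma T0 z'.2)).
  apply: (@C0_prod _ _ _ _ (fun S0 => c * kernel_G gamma T0 S0) (c * gamma 1)
    (@compact_ograss R n d hdn) (kC0 x)).
    by apply: continuous_mul; [exact: cst_continuous|exact: kernel_G_continuous].
  by move=> S0; rewrite normrM (gtr0_norm c0) ler_pM2l.
rewrite assX // assY //=.
have pull (Z : set M) (e : M -> R) : measurable Z -> (mu Z < +oo)%E ->
    measurable_fun Z e -> (forall y, `|e y| <= gamma 1) ->
    \int[mu]_(y in Z) (kernel_pos rho x y * (c * e y)) =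
    c * \int[mu]_(y in Z) (kernel_pos rho x y * e y).
  move=> mZ Zoo me eb; rewrite -RintegralZl //; last exact/intP/C0P/kC0.
  by apply: eq_Rintegral => y _; ring.
rewrite (pull X a) // (pull Y b) // -mulrBr => /eqP.
by rewrite mulf_eq0 (gt_eqF c0) /= => /eqP.
Qed.

End varifolds.

Theorem theorem3p5 (R : realType) (n d : nat) (hdn : (d <= n)%N)
  (rho gamma : R -> R)
  (rho_cont : {within `[0, +oo[, continuous rho})
  (gamma_cont : {within `[-1, 1], continuous gamma})
  (rho0 : 0 < rho 0)
  (kpos_pd : positive_definite_kernel (@kernel_pos R n rho))
  (kG_pd : positive_definite_kernel (@kernel_G R n d hdn gamma))
  (kpos_C0 : forall x : 'rV[R]_n, C0 (kernel_pos rho x))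
  (W : rkhs (@kernel_prod R n d hdn rho gamma))
  (kpos_universal : C0_universal (@kernel_pos R n rho))
  (gamma1 : 0 < gamma 1)
  (gamma_neq : forall t : R, -1 <= t <= 1 -> t != 0 -> gamma t <> gamma (- t))
  (X Y : set 'rV[R]_n) (T S : 'rV[R]_n -> ograss R hdn)
  (XT : oriented_rectifiable_set X T) (YS : oriented_rectifiable_set Y S)
  (X_fin : (hausdorff d X < +oo)%E) (Y_fin : (hausdorff d Y < +oo)%E)
  (muX muY : oriented_varifold R hdn)
  (muX_XT : associated_varifold X T muX) (muY_YS : associated_varifold Y S muY)
  (dist0 : dual_norm W (fun w => pairing muX w - pairing muY w) = 0%E) :
  hausdorff d (X `+` Y) = 0%E /\
  {ae @hausdorff_measure R n d, forall x, (X `&` Y) x -> T x = S x}.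
Proof.
have [_ mX mT _] := XT; have [_ mY mS _] := YS.
have [q qsep] := @separating_sequence R (ograss R hdn) (@compact_ograss R n d hdn).
pose a T0 := (fun y => kernel_G gamma T0 (T y)) \_ X.
pose b T0 := (fun y => kernel_G gamma T0 (S y)) \_ Y.
pose N := \bigcup_i [set y | a (q i) y != b (q i) y].
have N0 : hausdorff d N = 0%E.
  apply/eqP; rewrite eq_le hausdorff_ge0 andbT.
  apply: (le_trans (outer_measure_sigma_subadditive (@hausdorff R n d) _)).
  rewrite eseries0 // => i _ _.
  exact: (varifold_slice_null (q i) gamma_cont kG_pd kpos_C0 kpos_universal
    mX mY X_fin Y_fin mT mS muX_XT muY_YS dist0).
have abN y : ~ N y -> forall T0, a T0 y = b T0 y.
  move=> Ny T0; apply/eqP; rewrite -subr_eq0; apply/eqP; move: T0.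
  apply: qsep => [|i]; last first.
    apply/eqP; rewrite subr_eq0; apply/negP => /negP abi; apply: Ny.
    by exists i.
  (* Continuity is available in the second argument; symmetry moves [T0] there. *)
  have kGC (T0 T1 : ograss R hdn) : kernel_G gamma T0 T1 = kernel_G gamma T1 T0 :> R by case: kG_pd.
  have cont (Z : set 'rV[R]_n) (T1 : 'rV[R]_n -> ograss R hdn) :
      continuous (fun T0 => ((fun y => kernel_G gamma T0 (T1 y)) \_ Z) y : R).
    have -> : (fun T0 => ((fun y => kernel_G gamma T0 (T1 y)) \_ Z) y : R) =
        (fun T0 => if y \in Z then kernel_G gamma (T1 y) T0 else 0).
      by apply/funext => T0; rewrite patchE kGC.
    by case: (y \in Z); [exact: kernel_G_continuous|exact: cst_continuous].
  by move=> T0; exact: (cvgB (cont X T T0) (cont Y S T0)).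
have kG1 (T0 : ograss R hdn) : kernel_G gamma T0 T0 = gamma 1 :> R.
  by rewrite /kernel_G; have [-> _] := set_valP T0.
split.
  apply/eqP; rewrite eq_le hausdorff_ge0 andbT -N0; apply: le_hausdorff => y XYy.
  apply: contrapT => /abN ab; case: XYy => -[Zy nZy].
    have := ab (T y); rewrite /a /b !patchE mem_set // memNset // kG1 => g0.
    by move: gamma1; rewrite g0 ltxx.
  have := ab (S y); rewrite /a /b !patchE memNset // mem_set // kG1 => g0.
  by move: gamma1; rewrite -g0 ltxx.
exists N; split => //.
(* The exceptional set must be measurable, which null sets are for Caratheodory. *)
- exact: hausdorff_null_measurable.
- move=> y /= /not_implyP[[Xy Yy] TS]; apply: contrapT => /abN ab; apply: TS.
  apply: val_inj; apply: (oriented_planes_gamma_inj gamma_neq).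
  + exact: set_valP.
  + exact: set_valP.
  + move=> zeta zetaP; have := ab (SigSub (mem_set zetaP)).
    by rewrite /a /b !patchE !mem_set.
Qed.
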